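(* For every integer $n\ge 2$ and every real $t$, the moment-generating function $M_n(t)$ of distance on the lens space $L(n;1)$ is $$M_n(t)=\begin{cases}\dfrac{4}{\pi(4+t^2)}\left(\dfrac{2(e^{t\pi/2}-1)}{t}+t\,e^{t\pi/2}\right) & \text{if } n=2,\\[2ex] \dfrac{2n}{\pi(4+t^2)}\left(\dfrac{2(e^{t\pi/n}-1)}{t}+\tan\dfrac{\pi}{n}\left(e^{t\pi/2}-e^{t\pi/n}\right)\right) & \text{if } n\ge 3,\end{cases}$$ where at $t=0$ the right-hand sides are interpreted by continuity (i.e. as their limits as $t\to 0$).
   Context: Let $\mathbb{S}^3=\{(\alpha,\beta)\in\mathbb{C}^2 : |\alpha|^2+|\beta|^2=1\}$ with its round metric of constant curvature $1$, and let $Z_n\subset\mathbb{C}$ be the cyclic group of $n$th roots of unity acting freely on $\mathbb{S}^3$ by $\omega\cdot(\alpha,\beta)=(\omega\alpha,\omega\beta)$. The lens space $L(n;1)=\mathbb{S}^3/Z_n$ carries the unique Riemannian metric making the quotient map $\mathbb{S}^3\to L(n;1)$ a Riemannian submersion (here a local isometry). The associated Riemannian distance is $$d([p],[q])=\min_{\omega\in Z_n} d_{\mathbb{S}^3}(\omega\cdot p,q),\qquad d_{\mathbb{S}^3}(p,q)=\arccos(p\cdot q),$$ where $p\cdot q$ is the real Euclidean inner product on $\mathbb{R}^4=\mathbb{C}^2$. The moment-generating function of distance is $M_n(t)=\mathbb{E}[e^{t\,d(x,y)}]$, where $x,y$ are independent random points of $L(n;1)$, each distributed according to normalized Riemannian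 volume (the push-forward of the uniform probability measure on $\mathbb{S}^3$). *)

(* Defs.v *)
From HB Require Import structures.
From mathcomp Require Import all_boot all_order all_algebra generic_quotient.
From mathcomp Require Import complex.
From mathcomp Require Import all_classical all_reals all_analysis.
From mathcomp Require Import measurable_realfun.
From mathcomp Require Import ring lra.

Set Implicit Arguments.
Unset Strict Implicit.
Unset Printing Implicit Defensive.

Import Order.TTheory GRing.Theory Num.Theory.
Import numFieldNormedType.Exports.

Local Open Scope classical_set_scope.
Local Open Scope quotient_scope.
Local Open Scope ring_scope.

(* C^2 = R^4, with R^4 as a product of copies of R: R^4 carries the library's
   product sigma-algebra and product measures, R[i] * R[i] does not. Lebesgue
   measure lives on measurableTypeR R, which is R with its Borel sets. *)
Section coordinates.
Context {R : realType}.
Local Notation C := R[i].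
Local Notation mR := (measurableTypeR R).
Local Notation R4 := ((mR * mR) * (mR * mR))%type.

Definition of_R4 (x : R4) : C * C :=
  (Complex x.1.1 x.1.2, Complex x.2.1 x.2.2).

Definition to_R4 (p : C * C) : R4 :=
  ((complex.Re p.1, complex.Im p.1), (complex.Re p.2, complex.Im p.2)).

Definition R4_dot (x y : R4) : R :=
  x.1.1 * y.1.1 + x.1.2 * y.1.2 + x.2.1 * y.2.1 + x.2.2 * y.2.2.

Definition R4_norm (x : R4) : R := Num.sqrt (R4_dot x x).

Definition R4_scale (a : R) (x : R4) : R4 :=
  ((a * x.1.1, a * x.1.2), (a * x.2.1, a * x.2.2)).

Definition R4_unit_ball : set R4 := [set x | R4_norm x <= 1].

(* The library has no sigma-finite instance for a product of two Lebesgue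
   measures; it is needed to form the product on R^4. *)
Definition R2_lebesgue : set (mR * mR) -> \bar R :=
  (lebesgue_measure \x lebesgue_measure)%E.

HB.instance Definition _ := Measure.on R2_lebesgue.

Lemma R2_lebesgue_sigma_finite : sigma_finite setT R2_lebesgue.
Proof.
have /sigma_finiteP[F [TF ndF Foo]] := sigma_finiteT (@lebesgue_measure R).
exists (fun n => F n `*` F n).
  rewrite -setXTT {1 2}TF predeqE => -[x y]; split.
    move=> [/= [n _ Fnx] [k _ Fky]]; exists (maxn n k) => //; split.
    - by move: x Fnx; exact/subsetPset/ndF/leq_maxl.
    - by move: y Fky; exact/subsetPset/ndF/leq_maxr.
  by move=> [n _ []/= ? ?]; split; exists n.
move=> k; have [mF Fk] := Foo k; split; first exact: measurableX.
by rewrite /R2_lebesgue product_measure1E// lte_mul_pinfty// ge0_fin_numE.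
Qed.

HB.instance Definition _ := Measure_isSigmaFinite.Build _ _ _ R2_lebesgue
  R2_lebesgue_sigma_finite.

Definition R4_lebesgue : set R4 -> \bar R := (R2_lebesgue \x R2_lebesgue)%E.

HB.instance Definition _ := Measure.on R4_lebesgue.

Lemma to_R4K : cancel to_R4 of_R4.
Proof. by case=> [[a b] [c d]]. Qed.

Lemma of_R4K : cancel of_R4 to_R4.
Proof. by case=> [[a b] [c d]]. Qed.

Lemma measurable_R4_coord :
  [/\ measurable_fun [set: R4] (fun x : R4 => x.1.1 : R),
      measurable_fun [set: R4] (fun x : R4 => x.1.2 : R),
      measurable_fun [set: R4] (fun x : R4 => x.2.1 : R) &
      measurable_fun [set: R4] (fun x : R4 => x.2.2 : R)].
Proof.
split.
- exact: (measurableT_comp measurable_fst measurable_fst).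
- exact: (measurableT_comp measurable_snd measurable_fst).
- exact: (measurableT_comp measurable_fst measurable_snd).
- exact: (measurableT_comp measurable_snd measurable_snd).
Qed.

Lemma measurable_R4_norm : measurable_fun [set: R4] (R4_norm : R4 -> R).
Proof.
have [m1 m2 m3 m4] := measurable_R4_coord.
apply: (@measurableT_comp _ _ _ _ R R (@Num.sqrt R) _
  (fun x : R4 => R4_dot x x)).
  by apply: continuous_measurable_fun; exact: sqrt_continuous.
by rewrite /R4_dot; do 3?apply: measurable_funD; apply: measurable_funM.
Qed.

Lemma measurable_R4_unit_ball : measurable R4_unit_ball.
Proof.
rewrite [X in measurable X](_ : _ = R4_norm @^-1` `]-oo, 1%R]).
  by rewrite -[X in measurable X]setTI; exact: measurable_R4_norm.
by apply/seteqP; split=> x /=; rewrite in_itv.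
Qed.


Lemma R4_dotxx_ge0 (x : R4) : 0 <= R4_dot x x.
Proof. by rewrite /R4_dot -!expr2 !addr_ge0 ?sqr_ge0. Qed.

Lemma R4_dotZ (a b : R) (x y : R4) :
  R4_dot (R4_scale a x) (R4_scale b y) = a * b * R4_dot x y.
Proof. by rewrite /R4_dot /=; ring. Qed.

Lemma measurable_R4_scale (a : R4 -> R) : measurable_fun [set: R4] a ->
  measurable_fun [set: R4] (fun x => R4_scale (a x) x).
Proof.
move=> ma; have [m1 m2 m3 m4] := measurable_R4_coord.
have mM (f : R4 -> R) : measurable_fun [set: R4] f ->
    measurable_fun [set: R4] (fun x => a x * f x : mR).
  by move=> mf; exact: (measurable_funM ma mf).
apply: (measurable_fun_pair
  (f := fun x : R4 => (a x * x.1.1, a x * x.1.2) : mR * mR)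
  (g := fun x : R4 => (a x * x.2.1, a x * x.2.2) : mR * mR)).
- exact: (measurable_fun_pair (mM _ m1) (mM _ m2)).
- exact: (measurable_fun_pair (mM _ m3) (mM _ m4)).
Qed.

End coordinates.

Section sphere.
Variable R : realType.
Local Notation C := R[i].
Local Notation mR := (measurableTypeR R).
Local Notation R4 := ((mR * mR) * (mR * mR))%type.

Definition on_sphere3 : pred (C * C) :=
  [pred p | `|p.1| ^+ 2 + `|p.2| ^+ 2 == 1].

Record sphere3 := Sphere3 { sphere3_val :> C * C; _ : on_sphere3 sphere3_val }.

HB.instance Definition _ := [isSub for sphere3_val].
HB.instance Definition _ := [Choice of sphere3 by <:].

Lemma on_sphere3E (p : C * C) :
  on_sphere3 p = (R4_dot (to_R4 p) (to_R4 p) == 1).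
Proof.
case: p => [[a b] [c d]]; rewrite /on_sphere3 /R4_dot /= -!add_Re2_Im2.
by rewrite -rmorphD eq_complex /= eqxx andbT -!expr2 !addrA.
Qed.

Lemma on_sphere3_base : on_sphere3 (1, 0).
Proof. by rewrite /on_sphere3 /= normr1 normr0 expr1n expr0n addr0. Qed.

HB.instance Definition _ := isPointed.Build sphere3 (Sphere3 on_sphere3_base).

(* Borel sigma-algebra of S^3 as a subspace of R^4. *)
HB.instance Definition _ := Measurable.copy sphere3
  (g_sigma_algebra_preimageType (fun p : sphere3 => to_R4 p : R4)).

(* x / |x|; the value at the origin is irrelevant. *)
Definition radial_proj (x : R4) : sphere3 :=
  insubd (point : sphere3) (of_R4 (R4_scale (R4_norm x)^-1 x)).

Lemma radial_projE (x : R4) : R4_norm x != 0 ->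
  radial_proj x = of_R4 (R4_scale (R4_norm x)^-1 x) :> C * C.
Proof.
move=> x0; rewrite /radial_proj val_insubd on_sphere3E of_R4K R4_dotZ.
rewrite -(sqr_sqrtr (R4_dotxx_ge0 x)) -/(R4_norm x) ifT//.
by apply/eqP; field.
Qed.

Lemma measurable_radial_proj : measurable_fun [set: R4] radial_proj.
Proof.
move=> _ _ [B mB <-]; rewrite !setTI.
pose f (x : R4) : R4 := if R4_norm x == 0 then to_R4 (radial_proj x)
  else R4_scale (R4_norm x)^-1 x.
rewrite [X in measurable X](_ : _ = f @^-1` B).
  rewrite -[X in measurable X]setTI.
  suff mf : measurable_fun [set: R4] f by exact: mf.
  rewrite (_ : f = fun x => if R4_norm x == 0 then to_R4 (point : sphere3)
                            else R4_scale (R4_norm x)^-1 x); last first.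
    apply/funext => x; rewrite /f; case: ifPn => // /eqP x0.
    rewrite /radial_proj x0 invr0 /insubd insubF// on_sphere3E of_R4K.
    by rewrite /R4_dot /= !mul0r !addr0 eq_sym oner_eq0.
  apply: measurable_fun_ifT => //.
  - exact: (measurable_fun_eqr measurable_R4_norm (@measurable_cst _ _ _ R _ 0)).
  - apply: measurable_R4_scale.
    rewrite (_ : (fun _ => _) = (@powR R ^~ (-1)) \o R4_norm); last first.
      by apply/funext => x /=; rewrite powR_inv1// sqrtr_ge0.
    apply: (@measurableT_comp _ _ _ _ R R); first exact: measurable_powR.
    exact: measurable_R4_norm.
apply: (f_equal (fun g => g @^-1` B)); apply/funext => x; rewrite /f.
by case: ifPn => // x0; rewrite /= radial_projE// of_R4K.
Qed.

HB.instance Definition _ :=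
  isMeasurableFun.Build _ _ _ _ radial_proj measurable_radial_proj.

(* The volume of A is that of the cone {r p | p in A, 0 <= r <= 1}; this is one
   fourth of the Riemannian volume, a factor that normalization removes. *)
Definition sphere3_cone_measure : set sphere3 -> \bar R :=
  pushforward (mrestr R4_lebesgue measurable_R4_unit_ball) radial_proj.

Let cone0 : sphere3_cone_measure set0 = 0%E.
Proof. by rewrite /sphere3_cone_measure /pushforward preimage_set0 measure0. Qed.

Let cone_ge0 A : (0 <= sphere3_cone_measure A)%E.
Proof. exact: measure_ge0. Qed.

Let cone_sigma_additive : semi_sigma_additive sphere3_cone_measure.
Proof.
exact: (@measure_semi_sigma_additive _ _ _ (pushforward
  (mrestr R4_lebesgue measurable_R4_unit_ball) radial_proj)).
Qed.

HB.instance Definition _ := isMeasure.Build _ _ _ sphere3_cone_measure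
  cone0 cone_ge0 cone_sigma_additive.

Lemma sphere3_cone_measureT_fin_gt0 :
  (0 < sphere3_cone_measure setT < +oo)%E.
Proof.
rewrite /sphere3_cone_measure /pushforward /mrestr preimage_setT setTI.
have box (A B : set mR) : measurable A -> measurable B ->
    measurable ((A `*` B) `*` (A `*` B)) /\
    R4_lebesgue ((A `*` B) `*` (A `*` B)) =
    (lebesgue_measure A * lebesgue_measure B *
     (lebesgue_measure A * lebesgue_measure B))%E.
  move=> mA mB; split; first by apply: measurableX; exact: measurableX.
  have E : R2_lebesgue (A `*` B) = (lebesgue_measure A * lebesgue_measure B)%E.
    exact: product_measure1E.
  by rewrite -E; apply: product_measure1E; exact: measurableX.
have norm2 (x : R4) : (R4_norm x <= 1) = (R4_dot x x <= 1).
  by rewrite -[X in _ <= X]sqrtr1 /R4_norm ler_sqrt.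
apply/andP; split.
  have [mI II] := box _ _ (measurable_itv `[0 : R, 2^-1])
    (measurable_itv `[0 : R, 2^-1]).
  apply: (@lt_le_trans _ _ (R4_lebesgue ((`[0%R, 2^-1%R] `*` `[0%R, 2^-1%R]) `*`
    (`[0%R, 2^-1%R] `*` `[0%R, 2^-1%R])))).
    rewrite II !lebesgue_measure_itv /= lte_fin invr_gt0 ltr0n -EFinB subr0.
    by rewrite -!EFinM lte_fin !mulr_gt0 ?invr_gt0.
  apply: le_measure; rewrite ?inE//; first exact: measurable_R4_unit_ball.
  move=> [[a b] [c d]] /= [[]]; rewrite !in_itv /R4_unit_ball /= norm2 /R4_dot /=.
  by move=> /andP[? ?] /andP[? ?] [/andP[? ?] /andP[? ?]]; nra.
have [mI II] := box _ _ (measurable_itv `[-1 : R, 1])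
  (measurable_itv `[-1 : R, 1]).
apply: (@le_lt_trans _ _ (R4_lebesgue ((`[-1%R, 1%R] `*` `[-1%R, 1%R]) `*`
    (`[-1%R, 1%R] `*` `[-1%R, 1%R])))).
  apply: le_measure; rewrite ?inE//; first exact: measurable_R4_unit_ball.
  move=> [[a b] [c d]]; rewrite /R4_unit_ball /= norm2 /R4_dot /= !in_itv /= => h.
  by split; split; apply/andP; split; nra.
rewrite II !lebesgue_measure_itv /= lte_fin; case: ifP => _.
  by rewrite -?EFinB -!EFinM ltry.
by rewrite -?EFinM ltry.
Qed.

(* The second argument is the value of mnormalize on measures of total mass 0
   or +oo; see sphere3_probE. *)
Definition sphere3_prob : probability sphere3 R :=
  mnormalize sphere3_cone_measure (dirac (point : sphere3)).

Lemma sphere3_probE (A : set sphere3) : sphere3_prob A =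
  (sphere3_cone_measure A * (fine (sphere3_cone_measure setT))^-1%:E)%E.
Proof.
have /andP[m0 moo] := sphere3_cone_measureT_fin_gt0.
by rewrite /sphere3_prob /= /mnormalize gt_eqF//= lt_eqF.
Qed.

Definition sphere3_dist (p q : C * C) : R := acos (R4_dot (to_R4 p) (to_R4 q)).

End sphere.

Section lens.
Variables (R : realType) (n : nat).
Local Notation C := R[i].

Definition Zn : set C := [set w | n.-unity_root w].

Definition Zn_act (w : C) (p : C * C) : C * C := (w * p.1, w * p.2).

Definition same_orbit (p q : sphere3 R) : bool :=
  `[< exists2 w, Zn w & Zn_act w p = q >].

Lemma ZnP (w : C) : Zn w <-> w ^+ n = 1.
Proof. by rewrite /Zn /= unity_rootE; split=> /eqP. Qed.

Lemma Zn1 : Zn 1.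
Proof. by apply/ZnP; rewrite expr1n. Qed.

Lemma ZnM (v w : C) : Zn v -> Zn w -> Zn (v * w).
Proof. by move=> /ZnP v1 /ZnP w1; apply/ZnP; rewrite exprMn v1 w1 mulr1. Qed.

Lemma ZnV (w : C) : Zn w -> Zn w^-1.
Proof. by move=> /ZnP w1; apply/ZnP; rewrite exprVn w1 invr1. Qed.

Lemma Zn_actM v w p : Zn_act v (Zn_act w p) = Zn_act (v * w) p.
Proof. by rewrite /Zn_act /= !mulrA. Qed.

Lemma Zn_act1 p : Zn_act 1 p = p.
Proof. by case: p => a b; rewrite /Zn_act /= !mul1r. Qed.

Lemma Zn_act_neq0 w p (q : sphere3 R) : Zn_act w p = q -> w != 0.
Proof.
move=> wpq; apply/eqP => w0; have := valP q.
rewrite /= -wpq w0 /on_sphere3 /Zn_act /= !mul0r normr0 expr0n addr0.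
by rewrite eq_sym oner_eq0.
Qed.

Lemma same_orbit_refl : reflexive same_orbit.
Proof. by move=> p; apply/asboolP; exists 1; [exact: Zn1|exact: Zn_act1]. Qed.

Lemma same_orbit_sym : symmetric same_orbit.
Proof.
suff H p q : same_orbit p q -> same_orbit q p.
  by move=> p q; apply/idP/idP; exact: H.
move=> /asboolP[w Zw wpq]; apply/asboolP; exists w^-1; first exact: ZnV.
by rewrite -wpq Zn_actM mulVf ?Zn_act1// (Zn_act_neq0 wpq).
Qed.

Lemma same_orbit_trans : transitive same_orbit.
Proof.
move=> q p r /asboolP[v Zv vpq] /asboolP[w Zw wqr]; apply/asboolP.
by exists (w * v); [exact: ZnM|rewrite -Zn_actM vpq].
Qed.

Canonical same_orbit_equiv :=
  EquivRel same_orbit same_orbit_refl same_orbit_sym same_orbit_trans.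

Definition lens : Type := {eq_quot same_orbit}.

HB.instance Definition _ := Choice.on lens.
HB.instance Definition _ := EqQuotient.on lens.
HB.instance Definition _ := isPointed.Build lens (\pi_lens point).

Definition lens_pi (p : sphere3 R) : lens := \pi_lens p.

(* The largest sigma-algebra making lens_pi measurable, i.e. the Borel
   sigma-algebra of the quotient. *)
Definition lens_measurable : set (set lens) :=
  image_set_system setT lens_pi (@measurable _ (sphere3 R)).

Let lens_measurable0 : lens_measurable set0.
Proof.
by have [] := sigma_algebra_image lens_pi
  (@sigma_algebra_measurable _ (sphere3 R)).
Qed.

Let lens_measurableC A : lens_measurable A -> lens_measurable (~` A).
Proof.
by have [_ + _] := sigma_algebra_image lens_pi
  (@sigma_algebra_measurable _ (sphere3 R)); rewrite -setTD; exact.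
Qed.

Let lens_measurable_bigcup (F : (set lens)^nat) :
  (forall i, lens_measurable (F i)) -> lens_measurable (\bigcup_i F i).
Proof.
by have [_ _] := sigma_algebra_image lens_pi
  (@sigma_algebra_measurable _ (sphere3 R)); exact.
Qed.

HB.instance Definition _ := @isMeasurable.Build default_measure_display lens
  lens_measurable lens_measurable0 lens_measurableC lens_measurable_bigcup.

Lemma measurable_lens_pi : measurable_fun [set: sphere3 R] lens_pi.
Proof. by []. Qed.

HB.instance Definition _ :=
  isMeasurableFun.Build _ _ _ _ lens_pi measurable_lens_pi.

Definition lens_prob : probability lens R :=
  distribution (@sphere3_prob R) lens_pi.

(* For n > 0 the infimum is the minimum over a finite set and does not depend
   on the representatives, see lens_distE and lens_dist_min. *)
Definition lens_dist (x y : lens) : R :=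
  inf [set sphere3_dist (Zn_act w (repr x)) (repr y) | w in Zn].

Lemma Zn_dot (w : C) (p q : C * C) : (0 < n)%N -> Zn w ->
  R4_dot (to_R4 (Zn_act w p)) (to_R4 (Zn_act w q)) = R4_dot (to_R4 p) (to_R4 q).
Proof.
move=> n0 /ZnP wn; have : `|w| = 1.
  apply/eqP; rewrite -(pexpr_eq1 n0) ?normr_ge0//.
  by rewrite -normrX wn normr1.
case: w {wn} => a b w1.
have : complex.Re (`|Complex a b| ^+ 2) = 1 by rewrite w1 expr1n.
rewrite -add_Re2_Im2 /= => {w1}ab.
case: p q => [[p1 p2] [p3 p4]] [[q1 q2] [q3 q4]]; rewrite /R4_dot /=.
transitivity ((a ^+ 2 + b ^+ 2) * (p1 * q1 + p2 * q2 + p3 * q3 + p4 * q4)).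
  by ring.
by rewrite ab mul1r.
Qed.

Lemma lens_pi_repr (p : sphere3 R) :
  exists2 w, Zn w & Zn_act w p = repr (lens_pi p).
Proof.
have /eqmodP : lens_pi p = lens_pi (repr (lens_pi p)) by rewrite /lens_pi reprK.
by move=> /asboolP.
Qed.

Lemma lens_distE (p q : sphere3 R) : (0 < n)%N ->
  lens_dist (lens_pi p) (lens_pi q) =
  inf [set sphere3_dist (Zn_act w p) q | w in Zn].
Proof.
move=> n0; have [v Zv vp] := lens_pi_repr p; have [u Zu uq] := lens_pi_repr q.
have u0 := Zn_act_neq0 uq; have v0 := Zn_act_neq0 vp.
have E w : sphere3_dist (Zn_act w (Zn_act v p)) (Zn_act u q) =
    sphere3_dist (Zn_act (u^-1 * (w * v)) p) q.
  rewrite /sphere3_dist -(Zn_dot _ (Zn_act u q) n0 (ZnV Zu)).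
  by rewrite !Zn_actM mulVf// Zn_act1 mulrA.
rewrite /lens_dist -vp -uq; congr inf; apply/seteqP; split=> _ [w Zw <-].
  by exists (u^-1 * (w * v)); [apply: ZnM; [exact: ZnV|exact: ZnM]|rewrite E].
exists (u * (w * v^-1)); first by apply: ZnM => //; apply: ZnM => //; exact: ZnV.
by rewrite E -!mulrA mulVf// mulr1 mulKf.
Qed.

Lemma finite_Zn : (0 < n)%N -> finite_set Zn.
Proof.
move=> n0; have [s sE] := closed_field_poly_normal ('X^n - 1 : {poly C}).
apply: (sub_finite_set _ (finite_seq s)) => w /ZnP wn /=.
have : root ('X^n - 1 : {poly C}) w.
  by rewrite /root !hornerE wn subrr.
rewrite sE rootZ ?root_prod_XsubC//.
by rewrite lead_coef_eq0 -size_poly_eq0 size_XnsubC.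
Qed.

Lemma lens_dist_min (p q : sphere3 R) : (0 < n)%N ->
  exists2 w, Zn w &
    lens_dist (lens_pi p) (lens_pi q) = sphere3_dist (Zn_act w p) q /\
    forall v, Zn v -> sphere3_dist (Zn_act w p) q <= sphere3_dist (Zn_act v p) q.
Proof.
move=> n0; pose f w := sphere3_dist (Zn_act w p) q.
have argmin (s : seq C) x : exists2 y, y \in x :: s &
    forall z, z \in x :: s -> f y <= f z.
  elim: s x => [|z s IH] x.
    by exists x => [|z]; rewrite inE// => /eqP->.
  have [y ys ymin] := IH z; have [xy|yx] := leP (f x) (f y).
    exists x => [|t]; first exact: mem_head.
    by rewrite inE => /predU1P[->//|/ymin]; exact: le_trans.
  exists y => [|t]; first by rewrite inE ys orbT.
  by rewrite inE => /predU1P[->|/ymin//]; exact: ltW.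
have /finite_seqP[[|x s] Zs] := finite_Zn n0.
  by have := Zn1; rewrite Zs.
have [w ws wmin] := argmin s x; have Zw : Zn w by rewrite Zs.
have wm v : Zn v -> f w <= f v by rewrite {1}Zs; exact: wmin.
exists w => //; split=> //; rewrite lens_distE//; apply/eqP; rewrite eq_le.
apply/andP; split.
  by apply: ge_inf; [exists (f w) => _ [v Zv <-]; exact: wm|exists w].
by apply: lb_le_inf; [exists (f w); exists w|move=> _ [v Zv <-]; exact: wm].
Qed.

Definition lens_mgf (t : R) : \bar R :=
  ('M_(lens_prob \x lens_prob) (fun z => lens_dist z.1 z.2) t)%E.

End lens.

(* Main.v *)
Require Import Defs.
From HB Require Import structures.
From mathcomp Require Import all_boot all_order all_algebra.
From mathcomp Require Import complex.
From mathcomp Require Import all_classical all_reals all_analysis.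
From mathcomp Require Import measurable_realfun.
From mathcomp Require Import zify ring lra.

Set Implicit Arguments.
Unset Strict Implicit.
Unset Printing Implicit Defensive.

Import Order.TTheory GRing.Theory Num.Theory.
Import numFieldNormedType.Exports.

Local Open Scope classical_set_scope.
Local Open Scope ring_scope.

(* Write a = pi / n. The distance between the classes of p and q is the arc
   cosine of max_k Re (zeta^k <p, q>), with zeta = exp (2 i pi / n) and <p, q>
   the hermitian product. Since the measure on S^3 is invariant under SU(2),
   which acts transitively, <p, q> may be replaced by the first coordinate of
   p, which is uniform on the unit disk (Archimedes). The integrand on the disk
   is invariant under z |-> zeta z, and on the sector |arg z| < a the maximum is
   Re z; this leaves a one-variable integral, with a substitution x = cos r.
   The case t = 0 of the same integral gives the area of the disk. *)

(** * Maps preserving a measure *)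

(** No Jacobian enters. Every change of variables is assembled by Fubini from translations and
    dilations of the line: an element of SU(2) is a product of complex shears, and a shear
    translates one coordinate by an amount that depends only on the other one.

    Archimedes' statement rests on the fact that the squared radius of a point of the plane has
    constant density on [0, oo[. Replacing the second coordinate w by u = |z|^2 + |w|^2 therefore
    costs only a constant; for fixed u the first coordinate z fills the disk of squared radius u,
    and rescaling it to the unit disk gives a factor u for every integrand. The unknown constants
    (volume of the ball, area of the disk) cancel by taking the integrand 1.

    In the sector, the vertical chord at abscissa x ends on the two rays if x <= cos a, which
    produces the factor tan a, and on the circle if x > cos a. For n = 2 the sector is a half plane
    and tan a has no meaning; the sector is therefore described without quotients, and the range of
    x on which tan a would be used is then empty. *)

Section preserving_maps.
Context d (T : measurableType d) (R : realType).
Variable mu : {measure set T -> \bar R}.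

Definition preserves (phi : T -> T) : Prop :=
  measurable_fun setT phi /\
  forall A, measurable A -> mu (phi @^-1` A) = mu A.

Lemma preserves_comp phi psi :
  preserves phi -> preserves psi -> preserves (phi \o psi).
Proof.
move=> [mphi hphi] [mpsi hpsi]; split; first exact: measurableT_comp.
move=> A mA; rewrite comp_preimage hpsi ?hphi//.
by rewrite -[X in measurable X]setTI; exact: mphi.
Qed.

Lemma preserves_iter phi k : preserves phi -> preserves (iter k phi).
Proof.
move=> hphi; elim: k => [|k IH]; last exact: preserves_comp hphi IH.
by split=> //; exact: measurable_id.
Qed.

Lemma preserves_ge0_integral phi (f : T -> \bar R) : preserves phi ->
  measurable_fun setT f -> (forall x, 0 <= f x)%E ->
  (\int[mu]_x f (phi x) = \int[mu]_x f x)%E.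
Proof.
move=> [mphi hphi] mf f0.
have := @ge0_integral_pushforward _ _ _ _ R phi mphi mu setT f measurableT mf
  (fun x _ => f0 x).
rewrite preimage_setT => /= <-; apply: eq_measure_integral => A mA _.
exact: hphi.
Qed.

End preserving_maps.

Section skew_products.
Context d1 d2 (T1 : measurableType d1) (T2 : measurableType d2) (R : realType).
Variables (m1 : {sigma_finite_measure set T1 -> \bar R})
          (m2 : {sigma_finite_measure set T2 -> \bar R}).

(** Cavalieri: [\x] integrates the measures of the sections at fixed [x], and on each section the
    map acts as [S (x, _)]. *)
Lemma preserves_skewr (S : T1 * T2 -> T2) : measurable_fun setT S ->
  (forall x, preserves m2 (fun y => S (x, y))) ->
  preserves (m1 \x m2)%E (fun z => (z.1, S z)).
Proof.
move=> mS hS; split; first exact: measurable_fun_pair.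
move=> A mA; rewrite /product_measure1/=; apply: eq_integral => x _ /=.
rewrite -((hS x).2 _ (measurable_xsection x mA)).
by congr (m2 _); apply/seteqP; split=> y; rewrite /xsection /= !inE.
Qed.

(** The sections are now those at fixed [y], so [\x] is first traded for [\x^], which agrees with it
    on rectangles and hence everywhere. *)
Lemma preserves_skewl (S : T1 * T2 -> T1) : measurable_fun setT S ->
  (forall y, preserves m1 (fun x => S (x, y))) ->
  preserves (m1 \x m2)%E (fun z => (S z, z.2)).
Proof.
move=> mS hS; have mphi : measurable_fun setT (fun z : T1 * T2 => (S z, z.2)).
  exact: measurable_fun_pair.
have E B : measurable B -> (m1 \x m2)%E B = (m1 \x^ m2)%E B.
  move=> mB; apply: product_measure_unique => // C D mC mD.
  exact: product_measure2E.
split=> // A mA.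
have mpA : measurable ((fun z : T1 * T2 => (S z, z.2)) @^-1` A).
  by rewrite -[X in measurable X]setTI; exact: mphi.
rewrite [LHS](E _ mpA) [RHS](E _ mA).
rewrite /product_measure2/=; apply: eq_integral => y _ /=.
rewrite -((hS y).2 _ (measurable_ysection y mA)).
by congr (m1 _); apply/seteqP; split=> x; rewrite /ysection /= !inE.
Qed.

End skew_products.

(** * Lebesgue measure under affine maps of the line *)

Section lebesgue_affine.
Context {R : realType}.
Local Notation mR := (measurableTypeR R).
Local Notation leb := (@lebesgue_measure R).

(** By uniqueness of Lebesgue measure: [a] times the measure of the preimage gives half-open
    intervals their length. *)
Lemma lebesgue_measure_affine (a c : R) (A : set mR) : 0 < a -> measurable A ->
  leb ((fun x => a * x + c) @^-1` A) = (a^-1%:E * leb A)%E.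
Proof.
move=> a0 mA; pose phi (x : mR) : mR := a * x + c.
have mphi : measurable_fun setT phi.
  by apply: measurable_funD => //; exact: measurable_funM.
pose a' := NngNum (ltW a0).
have [nu nuE] : exists nu : {measure set mR -> \bar R},
    forall B, nu B = (a%:E * leb (phi @^-1` B))%E.
  by unshelve eexists (mscale a' (pushforward leb phi)).
suff -> : leb A = nu A by rewrite nuE muleA -EFinM mulVf ?gt_eqF// mul1e.
apply: lebesgue_measure_unique mA => _ [[x y]] /= _ <-; rewrite nuE.
rewrite (_ : phi @^-1` _ = `](x - c) / a, (y - c) / a]%classic).
  rewrite !lebesgue_measure_itv /= !lte_fin ltr_pdivrMr// divfK ?gt_eqF//.
  rewrite ltrBrDr subrK; case: ifPn => // xy; last by rewrite mule0.
  rewrite -!EFinB -EFinM; congr EFin; have : a != 0 by rewrite gt_eqF.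
  by move=> an0; field.
apply/seteqP; split=> z /=; rewrite !in_itv /= /phi ltr_pdivrMr// ler_pdivlMr//.
  by move=> /andP[h1 h2]; apply/andP; split; lra.
by move=> /andP[h1 h2]; apply/andP; split; lra.
Qed.

Lemma preserves_translation (c : R) : preserves leb (fun x : mR => x + c : mR).
Proof.
split; first by apply: measurable_funD.
move=> A mA; rewrite -[RHS]mul1e -[in RHS]invr1.
rewrite -(lebesgue_measure_affine c ltr01 mA).
by congr (leb _); apply/seteqP; split=> x /=; rewrite mul1r.
Qed.

Lemma ge0_integral_scale (a : R) (f : mR -> \bar R) : 0 < a ->
  measurable_fun setT f -> (forall x, 0 <= f x)%E ->
  (\int[leb]_x f (a * x)%R = a^-1%:E * \int[leb]_x f x)%E.
Proof.
move=> a0 mf f0; pose phi (x : mR) : mR := a * x.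
have mphi : measurable_fun setT phi by exact: measurable_funM.
have := @ge0_integral_pushforward _ _ _ _ R phi mphi leb setT f measurableT mf
  (fun x _ => f0 x).
rewrite preimage_setT => /= <-.
have a'0 : 0 <= a^-1 by rewrite invr_ge0 ltW.
rewrite -[a^-1]/((NngNum a'0)%:num) -ge0_integral_mscale//.
apply: eq_measure_integral => A mA _.
transitivity (a^-1%:E * leb A)%E; last by [].
rewrite -(lebesgue_measure_affine 0 a0 mA).
by congr (leb _); apply/seteqP; split=> x /=; rewrite addr0.
Qed.

End lebesgue_affine.

(** Recursion on the expression. The case of a difference precedes that of a sum, since [x - y] is
    [x + (- y)]. *)
Ltac polynomial_measurability :=
  lazymatch goal with
  | |- measurable_fun _ (fun x => pair (@?f x) (@?g x)) =>
      apply: measurable_fun_pair; polynomial_measurability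
  | |- measurable_fun _ (fun x => GRing.add (@?f x) (GRing.opp (@?g x))) =>
      apply: measurable_funB; polynomial_measurability
  | |- measurable_fun _ (fun x => GRing.add (@?f x) (@?g x)) =>
      apply: measurable_funD; polynomial_measurability
  | |- measurable_fun _ (fun x => GRing.mul (@?f x) (@?g x)) =>
      apply: measurable_funM; polynomial_measurability
  | |- measurable_fun _ (fun x => fst (fst x)) =>
      exact: (measurableT_comp measurable_fst measurable_fst)
  | |- measurable_fun _ (fun x => snd (fst x)) =>
      exact: (measurableT_comp measurable_snd measurable_fst)
  | |- measurable_fun _ (fun x => fst (snd x)) =>
      exact: (measurableT_comp measurable_fst measurable_snd)
  | |- measurable_fun _ (fun x => snd (snd x)) =>
      exact: (measurableT_comp measurable_snd measurable_snd)
  | |- measurable_fun _ (fun x => fst x) => exact: measurable_fst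
  | |- measurable_fun _ (fun x => snd x) => exact: measurable_snd
  | |- measurable_fun _ fst => exact: measurable_fst
  | |- measurable_fun _ snd => exact: measurable_snd
  | |- measurable_fun _ (fun _ => ?c) => exact: measurable_cst
  end.

(** * Rotations of the plane and the action of SU(2) on R^4 *)

Section plane_and_space.
Context {R : realType}.
Local Notation mR := (measurableTypeR R).
Local Notation leb := (@lebesgue_measure R).
Local Notation R2 := (mR * mR)%type.
Local Notation R4 := (R2 * R2)%type.
Local Notation leb2 := (@R2_lebesgue R).
Local Notation leb4 := (@R4_lebesgue R).

Lemma preserves_R2_translation (a b : R) :
  preserves leb2 (fun z : R2 => (z.1 + a, z.2 + b) : R2).
Proof.
have h1 : preserves (leb \x leb)%E (fun z : R2 => (z.1 + a : mR, z.2)).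
  apply: (@preserves_skewl _ _ _ _ R leb leb (fun z : R2 => z.1 + a : mR)) => [|y].
    by polynomial_measurability.
  exact: preserves_translation.
have h2 : preserves (leb \x leb)%E (fun z : R2 => (z.1, z.2 + b : mR)).
  apply: (@preserves_skewr _ _ _ _ R leb leb (fun z : R2 => z.2 + b : mR)) => [|y].
    by polynomial_measurability.
  exact: preserves_translation.
exact: preserves_comp h1 h2.
Qed.

Definition rot (c s : R) (z : R2) : R2 :=
  (c * z.1 - s * z.2, s * z.1 + c * z.2).

(* A rotation is a product of three shears. *)
Lemma preserves_rot (c s : R) : c ^+ 2 + s ^+ 2 = 1 -> s != 0 ->
  preserves leb2 (rot c s).
Proof.
move=> cs s0.
have hU k : preserves (leb \x leb)%E (fun z : R2 => (z.1 + k * z.2 : mR, z.2)).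
  apply: (@preserves_skewl _ _ _ _ R leb leb (fun z : R2 => z.1 + k * z.2 : mR)) => [|y].
    by polynomial_measurability.
  exact: (preserves_translation (k * y)).
have hL k : preserves (leb \x leb)%E (fun z : R2 => (z.1, z.2 + k * z.1 : mR)).
  apply: (@preserves_skewr _ _ _ _ R leb leb (fun z : R2 => z.2 + k * z.1 : mR)) => [|y].
    by polynomial_measurability.
  exact: (preserves_translation (k * y)).
(* For c = cos u and s = sin u the coefficient is - tan (u / 2). *)
have := preserves_comp (hU ((c - 1) / s))
  (preserves_comp (hL s) (hU ((c - 1) / s))).
rewrite (_ : _ \o _ = rot c s)//; apply/funext => -[x y].
have cE : c ^+ 2 = 1 - s ^+ 2 by rewrite -cs addrK.
by rewrite /rot /=; congr pair; field : cE.
Qed.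

(* The matrix (a, - b^*; b, a^* ) applied to x, with a = a1 + i a2 and
   b = b1 + i b2. *)
Definition SU2_act (a b : R2) (x : R4) : R4 :=
  ((a.1 * x.1.1 - a.2 * x.1.2 - b.1 * x.2.1 - b.2 * x.2.2,
    a.1 * x.1.2 + a.2 * x.1.1 - b.1 * x.2.2 + b.2 * x.2.1),
   (b.1 * x.1.1 - b.2 * x.1.2 + a.1 * x.2.1 + a.2 * x.2.2,
    b.1 * x.1.2 + b.2 * x.1.1 + a.1 * x.2.2 - a.2 * x.2.1)).

Lemma preserves_SU2_act (a b : R2) :
  a.1 ^+ 2 + a.2 ^+ 2 + b.1 ^+ 2 + b.2 ^+ 2 = 1 ->
  preserves leb4 (SU2_act a b).
Proof.
have hU (k : R2) : preserves leb4 (fun x : R4 =>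
    ((x.1.1 + (k.1 * x.2.1 - k.2 * x.2.2),
      x.1.2 + (k.1 * x.2.2 + k.2 * x.2.1)) : R2, x.2)).
  apply: (@preserves_skewl _ _ _ _ R leb2 leb2 (fun x : R4 =>
    (x.1.1 + (k.1 * x.2.1 - k.2 * x.2.2),
     x.1.2 + (k.1 * x.2.2 + k.2 * x.2.1)) : R2)) => [|y].
    by polynomial_measurability.
  exact: (preserves_R2_translation (k.1 * y.1 - k.2 * y.2)
    (k.1 * y.2 + k.2 * y.1)).
have hL (k : R2) : preserves leb4 (fun x : R4 =>
    (x.1, (x.2.1 + (k.1 * x.1.1 - k.2 * x.1.2),
           x.2.2 + (k.1 * x.1.2 + k.2 * x.1.1)) : R2)).
  apply: (@preserves_skewr _ _ _ _ R leb2 leb2 (fun x : R4 =>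
    (x.2.1 + (k.1 * x.1.1 - k.2 * x.1.2),
     x.2.2 + (k.1 * x.1.2 + k.2 * x.1.1)) : R2)) => [|y].
    by polynomial_measurability.
  exact: (preserves_R2_translation (k.1 * y.1 - k.2 * y.2)
    (k.1 * y.2 + k.2 * y.1)).
(* Upper and lower complex shears generate all the elements with b != 0. *)
have main (a' b' : R2) : b' != (0, 0) ->
    a'.1 ^+ 2 + a'.2 ^+ 2 + b'.1 ^+ 2 + b'.2 ^+ 2 = 1 ->
    preserves leb4 (SU2_act a' b').
  case: a' b' => [a1 a2] [b1 b2] /= b0 ab1.
  have N0 : b1 ^+ 2 + b2 ^+ 2 != 0.
    apply: contraNneq b0 => /eqP.
    by rewrite paddr_eq0 ?sqr_ge0// !sqrf_eq0 => /andP[/eqP-> /eqP->].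
  pose N := b1 ^+ 2 + b2 ^+ 2.
  (* As complex numbers, x = (a - 1) / b and y = (conj a - 1) / b: the diagonal entries of (1, x; 0,
     1) (1, 0; b, 1) (1, y; 0, 1) force these values. The upper right entry a y + x is then - conj b
     because |a|^2 + |b|^2 = 1. *)
  pose x : R2 := (((a1 - 1) * b1 + a2 * b2) / N, (a2 * b1 - (a1 - 1) * b2) / N).
  pose y : R2 := (((a1 - 1) * b1 - a2 * b2) / N, (- a2 * b1 - (a1 - 1) * b2) / N).
  have aN : a1 ^+ 2 + a2 ^+ 2 - 1 = - N by rewrite -ab1 /N; ring.
  have xb1 : x.1 * b1 - x.2 * b2 = a1 - 1 by rewrite /x /N /=; field.
  have xb2 : x.1 * b2 + x.2 * b1 = a2 by rewrite /x /N /=; field.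
  have yb1 : b1 * y.1 - b2 * y.2 = a1 - 1 by rewrite /y /N /=; field.
  have yb2 : b1 * y.2 + b2 * y.1 = - a2 by rewrite /y /N /=; field.
  have ay1 : a1 * y.1 - a2 * y.2 + x.1 = - b1.
    transitivity (b1 * (a1 ^+ 2 + a2 ^+ 2 - 1) / N).
      by rewrite /x /y /N /=; field.
    by rewrite aN /N; field.
  have ay2 : a1 * y.2 + a2 * y.1 + x.2 = b2.
    transitivity (- b2 * (a1 ^+ 2 + a2 ^+ 2 - 1) / N).
      by rewrite /x /y /N /=; field.
    by rewrite aN /N; field.
  have := preserves_comp (hU x) (preserves_comp (hL (b1, b2)) (hU y)).
  rewrite (_ : _ \o _ = SU2_act (a1, a2) (b1, b2))//.
  move: {aN} x y xb1 xb2 yb1 yb2 ay1 ay2 => [x1 x2] [y1 y2] /=.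
  move=> xb1 xb2 yb1 yb2 ay1 ay2.
  apply/funext => -[[X1 X2] [X3 X4]]; rewrite /SU2_act /=.
  congr (pair (pair _ _) (pair _ _)).
  - transitivity ((1 + (x1 * b1 - x2 * b2)) * (X1 + y1 * X3 - y2 * X4)
      - (x1 * b2 + x2 * b1) * (X2 + y1 * X4 + y2 * X3) + x1 * X3 - x2 * X4).
      by ring.
    rewrite xb1 xb2 -[b2]ay2 -[b1]opprK -ay1; ring.
  - transitivity ((1 + (x1 * b1 - x2 * b2)) * (X2 + y1 * X4 + y2 * X3)
      + (x1 * b2 + x2 * b1) * (X1 + y1 * X3 - y2 * X4) + x1 * X4 + x2 * X3).
      by ring.
    rewrite xb1 xb2 -[b2]ay2 -[b1]opprK -ay1; ring.
  - transitivity (b1 * X1 - b2 * X2 + (b1 * y1 - b2 * y2 + 1) * X3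
      - (b1 * y2 + b2 * y1) * X4); first by ring.
    by rewrite yb1 yb2; ring.
  - transitivity (b1 * X2 + b2 * X1 + (b1 * y1 - b2 * y2 + 1) * X4
      + (b1 * y2 + b2 * y1) * X3); first by ring.
    by rewrite yb1 yb2; ring.
move=> ab1; have [b0|bn0] := eqVneq b (0, 0); last exact: main bn0 ab1.
(* For b = 0 the diagonal matrix is a product of two antidiagonal ones, to which [main] applies; the
   lower left entry of the first is - conj a. *)
have h1 : preserves leb4 (SU2_act (0, 0) (- a.1, a.2)).
  apply: main.
  - apply/negP => /eqP[/eqP]; rewrite oppr_eq0 => /eqP a1 a2.
    move: ab1; rewrite a1 a2 b0 !expr0n /= !addr0 => /esym/eqP.
    by rewrite oner_eq0.
  - by rewrite /= sqrrN expr0n /= !add0r -ab1 b0 /= expr0n !addr0.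
have h2 : preserves leb4 (SU2_act (0, 0) (1, 0)).
  apply: main; last by rewrite /= expr0n expr1n /= !add0r addr0.
  by apply/negP => /eqP[/eqP]; rewrite oner_eq0.
rewrite (_ : SU2_act a b = SU2_act (0, 0) (- a.1, a.2) \o SU2_act (0, 0) (1, 0)).
  exact: preserves_comp h1 h2.
by apply/funext => -[[x1 x2] [x3 x4]]; rewrite /SU2_act b0 /=;
  congr (pair (pair _ _) (pair _ _)); ring.
Qed.

Lemma ge0_integral_R2_scale (a : R) (f : R2 -> \bar R) : 0 < a ->
  measurable_fun setT f -> (forall x, 0 <= f x)%E ->
  (\int[leb2]_z f (a * z.1, a * z.2)%R = (a ^- 2)%:E * \int[leb2]_z f z)%E.
Proof.
move=> a0 mf f0.
have mg : measurable_fun setT (fun z : R2 => f (a * z.1, a * z.2)).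
  apply: (measurableT_comp mf (g := fun z : R2 => (a * z.1, a * z.2) : R2)).
  by polynomial_measurability.
have fub (g : R2 -> \bar R) : measurable_fun setT g -> (forall x, 0 <= g x)%E ->
    (\int[leb2]_z g z = \int[leb]_x \int[leb]_y g (x, y))%E.
  by move=> mg' g0; exact: (fubini_tonelli1 g).
rewrite !fub//; under eq_integral => x _.
  rewrite (ge0_integral_scale (f := fun y => f (a * x, y)))//; last first.
    by apply: (measurableT_comp mf); apply: measurable_fun_pair.
  over.
have mF : measurable_fun setT (fun x : mR => \int[leb]_y f (x, y))%E.
  exact: measurable_fun_fubini_tonelli_F.
have F0 (x : mR) : (0 <= \int[leb]_y f (x, y))%E by exact: integral_ge0.
rewrite ge0_integralZl//; first last.
- by rewrite lee_fin invr_ge0 ltW.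
- by apply: (measurableT_comp mF); apply: measurable_funM.
rewrite (ge0_integral_scale (f := fun x => \int[leb]_y f (x, y))%E)//.
by rewrite muleA -EFinM -invfM -expr2.
Qed.

End plane_and_space.

(** * Reduction from the unit ball of R^4 to the unit disk *)

Lemma ge0_integral_mrestr d (T : measurableType d) (R : realType)
    (mu : {measure set T -> \bar R}) (D : set T) (mD : measurable D)
    (f : T -> \bar R) :
  measurable_fun setT f -> (forall x, 0 <= f x)%E ->
  (\int[mrestr mu mD]_x f x = \int[mu]_(x in D) f x)%E.
Proof.
move=> mf f0; have mDC : measurable (~` D) by exact: measurableC.
rewrite -[X in integral _ X f](setUv D) ge0_integral_setU//; first last.
- by rewrite /disj_set setICr.
- by rewrite setUv.
rewrite [X in (_ + X)%E]null_set_integral ?adde0//; last 2 first.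
- exact: measurable_funS mf.
- by transitivity (mu (~` D `&` D)); [by []|rewrite setICl measure0].
apply: eq_measure_integral => A mA AD.
by transitivity (mu (A `&` D)); [by []|rewrite setIidl].
Qed.

Section squared_radius.
Context {R : realType}.
Local Notation mR := (measurableTypeR R).
Local Notation leb := (@lebesgue_measure R).
Local Notation R2 := (mR * mR)%type.
Local Notation leb2 := (@R2_lebesgue R).

Definition sqnorm (z : R2) : R := z.1 ^+ 2 + z.2 ^+ 2.

(** Indexed by the squared radius, so that the area is linear in [r]. *)
Definition disk (r : R) : set R2 := [set z | sqnorm z <= r].

Lemma measurable_sqnorm : measurable_fun setT (sqnorm : R2 -> mR).
Proof.
rewrite (_ : sqnorm = fun z => z.1 * z.1 + z.2 * z.2).
  by polynomial_measurability.
by apply/funext => z; rewrite /sqnorm !expr2.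
Qed.

Lemma measurable_disk r : measurable (disk r).
Proof.
rewrite (_ : disk r = sqnorm @^-1` `]-oo, r]); last first.
  by apply/seteqP; split=> x /=; rewrite in_itv.
by rewrite -[X in measurable X]setTI; exact: measurable_sqnorm.
Qed.

Lemma disk_measure_lty r : (leb2 (disk r) < +oo)%E.
Proof.
pose b : R := 1 + `|r|.
apply: (@le_lt_trans _ _ (leb2 (`[- b, b] `*` `[- b, b]))).
  apply: le_measure; rewrite ?inE//; first exact: measurable_disk.
    exact: measurableX.
  move=> [x y]; rewrite /disk /sqnorm /= !in_itv /= => h.
  have rb : r <= b ^+ 2.
    have := ler_norm r; have := normr_ge0 r; rewrite /b; nra.
  have b0 : 0 <= b by rewrite addr_ge0.
  have bx : `|x| <= b.
    by rewrite -[b]ger0_norm// -ler_sqr ?nnegrE// !real_normK ?num_real//; nra.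
  have By : `|y| <= b.
    by rewrite -[b]ger0_norm// -ler_sqr ?nnegrE// !real_normK ?num_real//; nra.
  by rewrite -!ler_norml.
rewrite /R2_lebesgue product_measure1E//= !lebesgue_measure_itv /=.
by case: ifP => _; rewrite ?mule0 ?ltry// -?EFinB -EFinM ltry.
Qed.

Lemma disk_measure r : 0 <= r -> leb2 (disk r) = (r%:E * leb2 (disk 1))%E.
Proof.
rewrite le_eqVlt => /predU1P[<-|r0].
  rewrite mul0e (_ : disk 0 = [set 0] `*` [set 0]).
    rewrite /R2_lebesgue product_measure1E//=.
    by rewrite lebesgue_measure_set1 mule0.
  apply/seteqP; split=> -[x y]; rewrite /disk /sqnorm /=.
    move=> h; have : x ^+ 2 + y ^+ 2 == 0.
      by rewrite eq_le h addr_ge0 ?sqr_ge0.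
    by rewrite paddr_eq0 ?sqr_ge0// !sqrf_eq0 => /andP[/eqP-> /eqP->].
  by move=> [-> ->]; rewrite expr0n addr0.
have sr0 : 0 < (Num.sqrt r)^-1 by rewrite invr_gt0 sqrtr_gt0.
have mI : measurable_fun setT (EFin \o (\1_(disk 1) : R2 -> R)).
  apply/measurable_EFinP; apply: measurable_indic; exact: measurable_disk.
have I0 (z : R2) : (0 <= (EFin \o (\1_(disk 1) : R2 -> R)) z)%E.
  by rewrite lee_fin.
have := ge0_integral_R2_scale sr0 mI I0.
rewrite [in RHS]integral_indic//; last exact: measurable_disk.
rewrite setIT exprVn invrK sqr_sqrtr ?(ltW r0)// => <-.
rewrite -(setIT (disk r)) -integral_indic//; last exact: measurable_disk.
apply: eq_integral => z _ /=; congr EFin; rewrite !indicE; congr (_ %:R).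
congr nat_of_bool; apply: asbool_equiv_eq.
rewrite /disk /sqnorm /= !exprMn -mulrDr exprVn sqr_sqrtr ?(ltW r0)//.
by rewrite mulrC ler_pdivrMr// mul1r.
Qed.

(** Polar coordinates with the squared radius as variable. Both measures on the line agree on []a,
    b]], whose preimage under [sqnorm] is [disk b] minus [disk a], and half-open intervals determine
    a measure. *)
Lemma ge0_integral_sqnorm (g : mR -> \bar R) :
  measurable_fun setT g -> (forall x, 0 <= g x)%E ->
  (\int[leb2]_z g (sqnorm z) =
   leb2 (disk 1) * \int[leb]_(s in `[0%R, +oo[) g s)%E.
Proof.
move=> mg g0; set k := leb2 (disk 1).
have kfin : k \is a fin_num.
  by rewrite ge0_fin_numE; [exact: disk_measure_lty|exact: measure_ge0].
have k0 : 0 <= fine k by apply: fine_ge0; exact: measure_ge0.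
have [nu nuE] : exists nu : {measure set mR -> \bar R},
    forall B, nu B = leb2 (sqnorm @^-1` B).
  unshelve eexists (pushforward leb2 (sqnorm : R2 -> mR)) => //.
  exact: measurable_sqnorm.
pose m2 := mscale (NngNum k0) (mrestr leb (measurable_itv `[0 : R, +oo[)).
have m2E B : m2 B = (k * leb (B `&` `[0%R, +oo[))%E.
  by rewrite -[k in RHS]fineK.
have nu_m2 A : measurable A -> nu A = m2 A.
  move=> mA; refine (@measure_unique _ R mR (@ocitv R) (fun i => `]- i%:R, i%:R]%classic) _ _
    _ _ nu m2 _ _ A mA) => //.
  - exact: ocitvI.
  - by move=> i; exists (- i%:R, i%:R).
  - apply/seteqP; split=> // x _; exists (Num.bound `|x|) => //=.
    have := archi_boundP (normr_ge0 x); rewrite ltr_norml in_itv /=.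
    by move=> /andP[-> /ltW ->].
  - move=> _ [[a b] /= _ <-].
    rewrite nuE [RHS]m2E.
    have nuD : sqnorm @^-1` `]a, b] = disk b `\` disk a.
      apply/seteqP; split=> z; rewrite /disk /= in_itv /= ltNge.
        by move=> /andP[/negP].
      by move=> [-> /negP ->].
    have disk0 c : c < 0 -> disk c = set0.
      move=> c0; apply/seteqP; split=> // z; rewrite /disk /= => /le_lt_trans.
      by move=> /(_ _ c0); rewrite ltNge addr_ge0 ?sqr_ge0.
    rewrite nuD; have [b0|b0] := ltP b 0.
      rewrite disk0// set0D measure0 (_ : _ `&` _ = set0) ?measure0 ?mule0//.
      apply/seteqP; split=> // x /=; rewrite !in_itv /= andbT.
      by move=> [/andP[_ /le_lt_trans]] /(_ _ b0); rewrite ltNge => /negP.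
    have [a0|a0] := ltP a 0.
      rewrite (disk0 a)// setD0 disk_measure// muleC -/k.
      rewrite (_ : _ `&` _ = `[0, b]%classic).
        rewrite lebesgue_measure_itv /= lte_fin; case: ltgtP b0 => // [b0 _|<- _].
          by rewrite -EFinB subr0.
        by rewrite mule0.
      apply/seteqP; split=> x /=; rewrite !in_itv /= andbT.
        by move=> [/andP[_ ->] ->].
      by move=> /andP[x0 ->]; rewrite x0 (lt_le_trans a0 x0).
    have [ab|ba] := ltP a b; last first.
      rewrite (_ : disk b `\` disk a = set0).
        by rewrite measure0 set_itv_ge ?set0I ?measure0 ?mule0// bnd_simp -leNgt.
      rewrite setD_eq0 => z; rewrite /disk /= => zb; exact: le_trans zb ba.
    transitivity (leb2 (disk b) - leb2 (disk a))%E.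
      rewrite measureD; [|exact: measurable_disk..|exact: disk_measure_lty].
      rewrite setIidr// => z; rewrite /disk /= => za; exact: le_trans za (ltW ab).
    rewrite (disk_measure b0) (disk_measure a0) -/k.
    rewrite (_ : _ `&` _ = `]a, b]%classic).
      rewrite lebesgue_measure_itv /= lte_fin ab.
      by rewrite -(fineK kfin) -!EFinM -!EFinB; congr EFin; ring.
    apply/seteqP; split=> x /=; rewrite !in_itv /= andbT; first by case.
    by move=> /andP[ax ->]; rewrite ax (le_trans a0 (ltW ax)).
  - move=> i; rewrite nuE; apply: le_lt_trans (disk_measure_lty i%:R).
    apply: le_measure; rewrite ?inE; [|exact: measurable_disk|].
      rewrite -[X in measurable X]setTI; exact: measurable_sqnorm.
    by move=> z; rewrite /disk /= in_itv => /andP[].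
have <- : (\int[nu]_x g x = \int[leb2]_z g (sqnorm z))%E.
  have := @ge0_integral_pushforward _ _ _ _ R _ measurable_sqnorm leb2 setT g
    measurableT mg (fun x _ => g0 x).
  rewrite preimage_setT => /= <-; apply: eq_measure_integral.
    exact: measurable_sqnorm.
  by move=> mphi A mA _; rewrite nuE.
rewrite (eq_measure_integral m2); last by move=> A mA _; exact: nu_m2.
by rewrite ge0_integral_mscale// ge0_integral_mrestr//= fineK.
Qed.

End squared_radius.

Section ball_to_disk.
Context {R : realType}.
Local Notation mR := (measurableTypeR R).
Local Notation leb := (@lebesgue_measure R).
Local Notation R2 := (mR * mR)%type.
Local Notation R4 := (R2 * R2)%type.
Local Notation leb2 := (@R2_lebesgue R).
Local Notation leb4 := (@R4_lebesgue R).

Lemma sqnorm_ge0 (z : R2) : 0 <= sqnorm z.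
Proof. by rewrite addr_ge0 ?sqr_ge0. Qed.

Lemma R4_dot_sqnorm (x : R4) : R4_dot x x = sqnorm x.1 + sqnorm x.2.
Proof. by rewrite /R4_dot /sqnorm; ring. Qed.

Lemma R4_unit_ballE (x : R4) : R4_unit_ball x = (sqnorm x.1 + sqnorm x.2 <= 1).
Proof.
rewrite /R4_unit_ball /= /R4_norm R4_dot_sqnorm -[X in _ <= X]sqrtr1 ler_sqrt//.
Qed.

Lemma measurable_inv_sqrt :
  measurable_fun setT (fun u : mR => (Num.sqrt u)^-1 : mR).
Proof.
rewrite (_ : (fun _ => _) = (@powR R ^~ (-1)) \o (@Num.sqrt R)); last first.
  by apply/funext => u /=; rewrite powR_inv1// sqrtr_ge0.
apply: (@measurableT_comp _ _ _ _ R R); first exact: measurable_powR.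
by apply: continuous_measurable_fun; exact: sqrt_continuous.
Qed.

(* Archimedes: the projection of the normalized measure of S^3 to the first
   complex coordinate is uniform on the unit disk. *)
Lemma ge0_integral_ball_direction (phi : R2 -> \bar R) :
  measurable_fun setT phi -> (forall z, 0 <= phi z)%E ->
  (\int[leb4]_(x in R4_unit_ball)
      phi ((R4_norm x)^-1 * x.1.1, (R4_norm x)^-1 * x.1.2)%R =
   leb2 (disk 1) * \int[leb]_(u in `[0%R, 1%R]) u%:E *
   \int[leb2]_(z in disk 1) phi z)%E.
Proof.
move=> mphi phi0.
(* The integrand in the variables z and u = |x|^2. The condition [sqnorm p.1 <= p.2] says that |w|^2
   = u - |z|^2 is nonnegative, [p.2 <= 1] that x lies in the ball. *)
pose g (p : R2 * mR) : \bar R := if (sqnorm p.1 <= p.2) && (p.2 <= 1) then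
  phi ((Num.sqrt p.2)^-1 * p.1.1, (Num.sqrt p.2)^-1 * p.1.2) else 0%E.
have mg : measurable_fun setT g.
  apply: measurable_fun_ifT => //.
    apply: measurable_and; apply: measurable_fun_ler => //.
    exact: (measurableT_comp measurable_sqnorm measurable_fst).
  apply: (measurableT_comp mphi).
  have mi : measurable_fun setT (fun p : R2 * mR => (Num.sqrt p.2)^-1 : mR).
    exact: (measurableT_comp measurable_inv_sqrt measurable_snd).
  apply: measurable_fun_pair; apply: (measurable_funM mi).
    exact: (measurableT_comp measurable_fst measurable_fst).
  exact: (measurableT_comp measurable_snd measurable_fst).
have g0 p : (0 <= g p)%E by rewrite /g; case: ifP.
rewrite integral_mkcond.
transitivity (\int[leb4]_x g (x.1, (sqnorm x.1 + sqnorm x.2)%R))%E.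
  apply: eq_integral => x _; rewrite patchE /g /= lerDl sqnorm_ge0 /=.
  rewrite /R4_norm R4_dot_sqnorm (_ : (x \in _) = (sqnorm x.1 + sqnorm x.2 <= 1))//.
  by apply/idP/idP; rewrite inE R4_unit_ballE.
have mS : measurable_fun setT
    (fun x : R4 => (x.1, sqnorm x.1 + sqnorm x.2 : mR) : R2 * mR).
  apply: measurable_fun_pair; first exact: measurable_fst.
  apply: measurable_funD.
    exact: (measurableT_comp measurable_sqnorm measurable_fst).
  exact: (measurableT_comp measurable_sqnorm measurable_snd).
have mgz z : measurable_fun setT (fun u : mR => g (z, u)).
  by apply: (measurableT_comp mg); exact: measurable_fun_pair.
(* For fixed z, the integral over w becomes one over s = |w|^2, and u is s translated by |z|^2. *)
transitivity (\int[leb2]_z (leb2 (disk 1) * \int[leb]_u g (z, u)))%E.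
  have := @fubini_tonelli1 _ _ _ _ R leb2 leb2
    (fun x : R4 => g (x.1, (sqnorm x.1 + sqnorm x.2)%R)).
  move=> ->//; last exact: (measurableT_comp mg).
  apply: eq_integral => z _; rewrite /fubini_F /=.
  have mt : measurable_fun setT (fun s : mR => g (z, s + sqnorm z)).
    by apply: (measurableT_comp (mgz z)); exact: measurable_funD.
  transitivity (leb2 (disk 1) *
      \int[leb]_(s in `[0%R, +oo[) g (z, (s + sqnorm z)%R))%E.
    rewrite -(ge0_integral_sqnorm mt)//.
    by apply: eq_integral => w _; rewrite addrC.
  congr (_ * _)%E.
  rewrite integral_mkcond.
  rewrite -(preserves_ge0_integral (preserves_translation (sqnorm z)) (mgz z))//.
  apply: eq_integral => s _; rewrite patchE; case: ifPn => //.
  rewrite notin_setE /= in_itv /= andbT => /negP; rewrite -ltNge => s0.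
  by rewrite /g /= lerDr leNgt s0.
have mF : measurable_fun setT (fun z => \int[leb]_u g (z, u))%E.
  exact: (measurable_fun_fubini_tonelli_F (m2 := leb) g mg g0).
rewrite ge0_integralZl//; last by move=> z _; exact: integral_ge0.
rewrite -muleA; congr (_ * _)%E.
rewrite (fubini_tonelli (m1 := leb2) (m2 := leb) g)//.
have G0 : (0 <= \int[leb2]_(z in disk 1) phi z)%E by exact: integral_ge0.
transitivity (\int[leb]_(u in `[0%R, 1%R])
  (u%:E * \int[leb2]_(z in disk 1) phi z))%E; last first.
  rewrite ge0_integralZr//.
  by move=> u /=; rewrite in_itv /= lee_fin => /andP[].
rewrite [RHS]integral_mkcond; apply: eq_integral => u _; rewrite patchE.
case: ifPn; last first.
  rewrite notin_setE /= in_itv /= => /negP u01; rewrite integral0_eq// => z _.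
  rewrite /g /=; case: ifPn => // /andP[zu u1].
  by rewrite u1 (le_trans (sqnorm_ge0 z) zu) in u01.
rewrite inE /= in_itv /= => /andP[].
rewrite le_eqVlt => /predU1P[<- _|u0 u1].
  (* At u = 0 there is nothing to rescale, but the domain [disk 0] is a null set. *)
  rewrite mul0e; transitivity (\int[leb2]_(z in disk 0) g (z, 0%R))%E.
    rewrite [RHS]integral_mkcond; apply: eq_integral => z _; rewrite patchE.
    case: ifPn => //; rewrite notin_setE /disk /= /g /= => /negP/negbTE ->//.
  apply: null_set_integral; first exact: measurable_disk.
    apply: measurable_funTS.
    by apply: (measurableT_comp mg); exact: measurable_fun_pair.
  by have := @disk_measure R 0 (lexx 0); rewrite mul0e.
have su0 : 0 < (Num.sqrt u)^-1 by rewrite invr_gt0 sqrtr_gt0.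
have mG : measurable_fun setT (phi \_ (disk 1)).
  apply/(measurable_restrictT phi (measurable_disk 1)).
  exact: measurable_funTS.
have G00 z : (0 <= (phi \_ (disk 1)) z)%E by exact: erestrict_ge0.
have E := ge0_integral_R2_scale su0 mG G00.
rewrite exprVn invrK sqr_sqrtr ?(ltW u0)// in E.
rewrite [in RHS]integral_mkcond -E.
apply: eq_integral => z _; rewrite /g /= u1 andbT patchE.
congr (if _ then _ else _); apply/idP/idP.
  move=> zu; rewrite inE /disk /sqnorm /= !exprMn -mulrDr exprVn.
  by rewrite sqr_sqrtr ?(ltW u0)// mulrC ler_pdivrMr// mul1r.
rewrite inE /disk /sqnorm /= !exprMn -mulrDr exprVn sqr_sqrtr ?(ltW u0)//.
by rewrite mulrC ler_pdivrMr// mul1r.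
Qed.

End ball_to_disk.

(** * Distance on the lens space *)

Section distance_formula.
Variables (R : realType) (n : nat).
Hypothesis n_gt1 : (1 < n)%N.
Local Notation mR := (measurableTypeR R).
Local Notation R2 := (mR * mR)%type.
Local Notation R4 := (R2 * R2)%type.
Local Notation C := R[i].

(** Half the argument of zeta^k. The comparison of real parts in [unit_rot_re] factors in terms of
    half angles, and these stay in ]0, pi[ for 0 < k < n, where the sine is positive. *)
Definition half_angle (k : nat) : R := pi / n%:R * k%:R.

Definition unit_rot (k : nat) : R2 -> R2 :=
  rot (cos (half_angle k *+ 2)) (sin (half_angle k *+ 2)).

(** The default value [z.1] is the term k = 0, so it does not change the maximum. *)
Definition max_re (z : R2) : R :=
  \big[Order.max/z.1]_(k < n) (unit_rot k z).1.

Lemma half_angleS k : half_angle k.+1 = half_angle 1 + half_angle k.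
Proof. by rewrite /half_angle -mulrDr -natrD. Qed.

Lemma half_anglen : half_angle n = pi.
Proof. by rewrite /half_angle divfK// pnatr_eq0 -lt0n ltnW. Qed.

Lemma half_angle_itv k : (0 < k < n)%N -> 0 < half_angle k < pi.
Proof.
move=> /andP[k0 kn]; have n0 : (0 : R) < n%:R by rewrite ltr0n ltnW.
apply/andP; split; rewrite /half_angle.
  by rewrite mulr_gt0 ?ltr0n// divr_gt0 ?pi_gt0.
by rewrite mulrAC ltr_pdivrMr// ltr_pM2l ?pi_gt0// ltr_nat.
Qed.

Lemma sin_half_angle_gt0 k : (0 < k < n)%N -> 0 < sin (half_angle k).
Proof. by move=> /half_angle_itv; exact: sin_gt0_pi. Qed.

Lemma unit_rot0 z : unit_rot 0 z = z.
Proof.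
case: z => x y; rewrite /unit_rot /half_angle mulr0 mul0rn sin0 cos0 /rot /=.
by rewrite !mul0r !mul1r subr0 add0r.
Qed.

Lemma unit_rotS k z : unit_rot k.+1 z = unit_rot 1 (unit_rot k z).
Proof.
rewrite /unit_rot (half_angleS k) mulrnDl.
set a := _ *+ 2; set b := _ *+ 2; rewrite (cosD a) (sinD a) /rot /=.
by congr pair; ring.
Qed.

Lemma unit_rot_iter k z : unit_rot k z = iter k (unit_rot 1) z.
Proof. by elim: k => [|k IH]; rewrite ?unit_rot0// unit_rotS IH. Qed.

Lemma unit_rotn z : unit_rot n z = z.
Proof.
rewrite /unit_rot half_anglen cos2pi sin2pi; case: z => x y.
by rewrite /rot /= !mul0r !mul1r subr0 add0r.
Qed.

Lemma unit_rotD j k z : unit_rot (j + k) z = unit_rot j (unit_rot k z).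
Proof. by rewrite !unit_rot_iter iterD. Qed.

Lemma sqnorm_unit_rot k z : sqnorm (unit_rot k z) = sqnorm z.
Proof.
rewrite /sqnorm /unit_rot /rot /=; set c := cos _; set s := sin _.
transitivity ((c ^+ 2 + s ^+ 2) * (z.1 ^+ 2 + z.2 ^+ 2)); first by ring.
by rewrite cos2Dsin2 mul1r.
Qed.

Lemma max_re_ge k z : (k < n)%N -> (unit_rot k z).1 <= max_re z.
Proof.
move=> kn; rewrite /max_re.
exact: (le_bigmax_cond _ (fun i : 'I_n => (unit_rot i z).1)
  (isT : xpredT (Ordinal kn))).
Qed.

Lemma max_re_attained z : exists2 k, (k < n)%N & max_re z = (unit_rot k z).1.
Proof.
rewrite /max_re; elim/big_ind: _ => [|x y [j jn ->] [k kn ->]|k _].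
- by exists 0%N; rewrite ?unit_rot0// ltnW.
- by case: leP => _; [exists k|exists j].
- by exists k.
Qed.

(** Rotation permutes the terms cyclically; in each inequality one index wraps around by
    [unit_rotn]. *)
Lemma max_re_unit_rot z : max_re (unit_rot 1 z) = max_re z.
Proof.
apply/eqP; rewrite eq_le; apply/andP; split.
  have [k kn ->] := max_re_attained (unit_rot 1 z); rewrite -unit_rotD addn1.
  have [kn1|] := ltnP k.+1 n; first exact: max_re_ge.
  rewrite leq_eqVlt ltnNge kn orbF => /eqP <-; rewrite unit_rotn.
  by rewrite -[z in X in X <= _]unit_rot0 max_re_ge// ltnW.
have [[|k] kn ->] := max_re_attained z; last first.
  by rewrite -addn1 unit_rotD max_re_ge// ltnW.
have E : unit_rot n.-1 (unit_rot 1 z) = z.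
  by rewrite -unit_rotD addn1 prednK ?unit_rotn// ltnW.
by rewrite unit_rot0 -[z in X in X <= _]E max_re_ge// ltn_predL ltnW.
Qed.

Lemma measurable_max_re : measurable_fun setT (max_re : R2 -> mR).
Proof.
have mrot k : measurable_fun setT (fun z : R2 => (unit_rot k z).1 : mR).
  by rewrite /unit_rot /rot /=; polynomial_measurability.
rewrite /max_re; under eq_fun do rewrite -(big_mkord xpredT
  (fun k => (unit_rot k _).1)).
elim: (index_iota 0 n) => [|k s IH].
  by under eq_fun do rewrite big_nil; exact: measurable_fst.
under eq_fun do rewrite big_cons.
exact: (measurable_maxr (mrot k) IH).
Qed.

Definition unit_root (k : nat) : C :=
  Complex (cos (half_angle k *+ 2)) (sin (half_angle k *+ 2)).

Lemma unit_rootX k : unit_root 1 ^+ k = unit_root k.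
Proof.
elim: k => [|k IH].
  by rewrite /unit_root /half_angle mulr0 mul0rn sin0 cos0 expr0.
rewrite exprS IH /unit_root (half_angleS k) mulrnDl.
set a := _ *+ 2; set b := _ *+ 2; rewrite (cosD a) (sinD a).
by apply/eqP; rewrite eq_complex /=; apply/andP; split; apply/eqP; ring.
Qed.

(** If zeta^k = 1 with 0 < k < n, then cos (2 h) = 1 for h = [half_angle k], so sin h = 0, although
    h lies in ]0, pi[. *)
Lemma primitive_unit_root : n.-primitive_root (unit_root 1).
Proof.
rewrite /primitive_root_of_unity (ltnW n_gt1) /=; apply/forallP => i.
rewrite unity_rootE unit_rootX.
have [->|ne] := eqVneq i.+1 n.
  by apply/eqP; rewrite /unit_root half_anglen cos2pi sin2pi; exact: eqxx.
have i1n : (0 < i.+1 < n)%N by rewrite /= ltn_neqAle ne ltn_ord.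
apply/eqP/negbTE; apply/negP => /eqP[].
rewrite cos_mulr2n cos2sin2 => + _; have := sin_half_angle_gt0 i1n.
set s := sin _ => s0 h; have : s ^+ 2 = 0 by lra.
by move=> /eqP; rewrite sqrf_eq0 gt_eqF.
Qed.

Lemma Zn_unit_root (w : C) : Zn n w <-> exists2 k, (k < n)%N & w = unit_root k.
Proof.
split=> [/ZnP wn|[k _ ->]].
  have [k ->] := prim_rootP primitive_unit_root wn.
  by exists k; rewrite ?unit_rootX.
apply/ZnP; rewrite -unit_rootX exprAC.
by rewrite (prim_expr_order primitive_unit_root) expr1n.
Qed.

(** Conjugation is on [y], so that multiplying [x] by zeta^k rotates the value by the same factor;
    the first component is [R4_dot x y]. *)
Definition hermitian (x y : R4) : R2 :=
  (x.1.1 * y.1.1 + x.1.2 * y.1.2 + (x.2.1 * y.2.1 + x.2.2 * y.2.2),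
   x.1.2 * y.1.1 - x.1.1 * y.1.2 + (x.2.2 * y.2.1 - x.2.1 * y.2.2)).

Lemma R4_dot_unit_root k (p : C * C) (y : R4) :
  R4_dot (to_R4 (Zn_act (unit_root k) p)) y =
  (unit_rot k (hermitian (to_R4 p) y)).1.
Proof.
case: p y => [[a b] [c d]] [[y1 y2] [y3 y4]].
by rewrite /R4_dot /unit_rot /rot /hermitian /=; ring.
Qed.

(** Expand |x - y|^2 >= 0 and |x + y|^2 >= 0. *)
Lemma R4_dot_itv (x y : R4) : R4_dot x x = 1 -> R4_dot y y = 1 ->
  -1 <= R4_dot x y <= 1.
Proof.
case: x y => [[x1 x2] [x3 x4]] [[y1 y2] [y3 y4]]; rewrite /R4_dot /= => hx hy.
have := sqr_ge0 (x1 - y1); have := sqr_ge0 (x2 - y2).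
have := sqr_ge0 (x3 - y3); have := sqr_ge0 (x4 - y4).
have := sqr_ge0 (x1 + y1); have := sqr_ge0 (x2 + y2).
have := sqr_ge0 (x3 + y3); have := sqr_ge0 (x4 + y4).
by move=> *; apply/andP; split; nra.
Qed.

Lemma le_acos (x y : R) : -1 <= x -> y <= 1 -> x <= y -> acos y <= acos x.
Proof.
move=> x1 y1 xy; rewrite leNgt; apply/negP.
have hx : -1 <= x <= 1 by rewrite x1 (le_trans xy).
have hy : -1 <= y <= 1 by rewrite y1 (le_trans x1 xy).
rewrite -ltr_cos ?in_itv /= ?acos_ge0 ?acos_lepi//.
by rewrite !acosK ?in_itv//= ltNge xy.
Qed.

(** Since [acos] is decreasing, the least distance belongs to the greatest real part; both extrema
    are attained, and comparing the two optimal rotations gives the two inequalities. *)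
Lemma lens_dist_max_re (p q : sphere3 R) :
  lens_dist (lens_pi n p) (lens_pi n q) =
  acos (max_re (hermitian (to_R4 p) (to_R4 q))).
Proof.
have dot1 (r : sphere3 R) : R4_dot (to_R4 r) (to_R4 r) = 1.
  by apply/eqP; rewrite -on_sphere3E; exact: (valP r).
have [w /[dup] Zw /Zn_unit_root[j jn wE] [-> wmin]] :=
  lens_dist_min p q (ltnW n_gt1).
have [k kn kE] := max_re_attained (hermitian (to_R4 p) (to_R4 q)).
have itv i : -1 <= (unit_rot i (hermitian (to_R4 p) (to_R4 q))).1 <= 1.
  rewrite -R4_dot_unit_root; apply: R4_dot_itv => //.
  rewrite (Zn_dot _ _ (ltnW n_gt1))//; apply/ZnP; rewrite -unit_rootX exprAC.
  by rewrite (prim_expr_order primitive_unit_root) expr1n.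
apply/eqP; rewrite eq_le; apply/andP; split.
  have Zk : Zn n (unit_root k) by apply/Zn_unit_root; exists k.
  have := wmin _ Zk.
  by rewrite /sphere3_dist (R4_dot_unit_root k) -kE.
rewrite /sphere3_dist wE R4_dot_unit_root; apply: le_acos.
- by have /andP[] := itv j.
- by rewrite kE; have /andP[] := itv k.
- exact: max_re_ge.
Qed.

End distance_formula.

Lemma measurable_implb d (T : measurableType d) (b c : T -> bool) :
  measurable_fun setT b -> measurable_fun setT c ->
  measurable_fun setT (fun x => b x ==> c x).
Proof.
move=> mb mc; rewrite (_ : (fun _ => _) = fun x => ~~ b x || c x).
  by apply: measurable_or => //; exact: measurable_neg.
by apply/funext => x; rewrite implybE.
Qed.

(** * A measurable section of the quotient map *)

Section measurable_section.
Variables (R : realType) (n : nat).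
Hypothesis n_gt1 : (1 < n)%N.
Local Notation mR := (measurableTypeR R).
Local Notation R2 := (mR * mR)%type.
Local Notation R4 := (R2 * R2)%type.
Local Notation S3 := (sphere3 R).
Local Notation zeta k := (unit_root R n k).

Definition sphere_R4 (p : S3) : R4 := to_R4 p.

Lemma measurable_sphere_R4 : measurable_fun setT sphere_R4.
Proof. by move=> _ B mB; rewrite setTI; exists B => //; rewrite setTI. Qed.

Lemma measurable_to_sphere d (T : measurableType d) (f : T -> S3) :
  measurable_fun setT (sphere_R4 \o f) -> measurable_fun setT f.
Proof. by move=> mf _ _ [B mB <-]; have := mf measurableT B mB; rewrite !setTI. Qed.

Lemma sphere_R4_inj : injective sphere_R4.
Proof. by move=> p q /(can_inj (@to_R4K R)) /val_inj. Qed.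

Lemma Zn_unit_root_mem k : Zn n (zeta k).
Proof.
apply/ZnP; rewrite -unit_rootX exprAC.
by rewrite (prim_expr_order (primitive_unit_root R n_gt1)) expr1n.
Qed.

Definition sphere_rot (k : nat) (p : S3) : S3 :=
  insubd (point : S3) (Zn_act (zeta k) p).

Lemma sphere_rotE k p : sphere_rot k p = Zn_act (zeta k) p :> R[i] * R[i].
Proof.
rewrite /sphere_rot val_insubd on_sphere3E.
rewrite (Zn_dot _ _ (ltnW n_gt1) (Zn_unit_root_mem k)) -on_sphere3E.
by rewrite ifT//; exact: (valP p).
Qed.

Lemma measurable_sphere_rot k : measurable_fun setT (sphere_rot k).
Proof.
apply: measurable_to_sphere.
pose c := cos (half_angle R n k *+ 2); pose s := sin (half_angle R n k *+ 2).
pose r (x : R4) : R4 :=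
  ((c * x.1.1 - s * x.1.2, c * x.1.2 + s * x.1.1),
   (c * x.2.1 - s * x.2.2, c * x.2.2 + s * x.2.1)).
rewrite (_ : _ \o _ = r \o sphere_R4).
  apply: (measurableT_comp _ measurable_sphere_R4).
  by rewrite /r; polynomial_measurability.
apply/funext => p; rewrite /sphere_R4 /= sphere_rotE /r.
by case: (p : R[i] * R[i]) => [[a b] [a' b']].
Qed.

Lemma lens_pi_eq (p q : S3) :
  lens_pi n p = lens_pi n q <-> exists k, q = sphere_rot k p.
Proof.
split=> [/eqmodP/asboolP[w /(Zn_unit_root n_gt1)[k _ ->] E]|[k ->]].
  by exists k; apply: val_inj; rewrite /= sphere_rotE.
apply/eqmodP/asboolP; exists (zeta k); first exact: Zn_unit_root_mem.
by rewrite sphere_rotE.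
Qed.

(** The lexicographic product is totally ordered and the key is injective, so a maximum over a
    finite orbit exists and is unique. *)
Definition lex_key (p : S3) : (R *l R) *l (R *l R) :=
  ((sphere_R4 p).1, (sphere_R4 p).2).

Lemma lex_key_inj : injective lex_key.
Proof.
move=> p q E; apply: sphere_R4_inj; move: E; rewrite /lex_key.
by case: (sphere_R4 p) => [[a b] [c d]]; case: (sphere_R4 q) => [[a' b'] [c' d']].
Qed.

(* A measurable fundamental domain of the action of Z_n: every orbit contains
   exactly one lexicographically maximal point. *)
Definition lex_max : set S3 :=
  [set p | forall k, (lex_key (sphere_rot k p) <= lex_key p)%O].

Lemma lex_max_exists (p : S3) : exists k, lex_max (sphere_rot k p).
Proof.
pose i0 : 'I_n := Ordinal (ltnW n_gt1).
have [i _ imax] := Order.TotalTheory.arg_maxP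
  (fun k : 'I_n => lex_key (sphere_rot k p)) (erefl : xpredT i0).
exists i => k.
have /(Zn_unit_root n_gt1)[j jn jE] :=
  ZnM (Zn_unit_root_mem k) (Zn_unit_root_mem i).
have -> : sphere_rot k (sphere_rot i p) = sphere_rot j p.
  by apply: val_inj; rewrite /= !sphere_rotE Zn_actM jE.
exact: (imax (Ordinal jn)).
Qed.

Lemma lex_max_unique (p q : S3) : lex_max p -> lex_max q ->
  lens_pi n p = lens_pi n q -> p = q.
Proof.
move=> hp hq pq; apply: lex_key_inj; apply/le_anti.
have [k qE] := (lens_pi_eq p q).1 pq.
have [j pE] := (lens_pi_eq q p).1 (esym pq).
have pq' := hq j; rewrite -pE in pq'.
have qp' := hp k; rewrite -qE in qp'.
exact/andP.
Qed.

Lemma measurable_lex_max : measurable lex_max.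
Proof.
have -> : lex_max =
    \bigcap_k [set p | (lex_key (sphere_rot k p) <= lex_key p)%O].
  by apply/seteqP; split=> [p h k _|p h k]; exact: h.
apply: bigcapT_measurable => k.
have [m1 m2 m3 m4] := @measurable_R4_coord R.
have mS := measurable_sphere_R4.
have mT : measurable_fun setT (sphere_R4 \o sphere_rot k).
  exact: measurableT_comp mS (measurable_sphere_rot k).
have mle (f : R4 -> R) : measurable_fun setT f ->
    measurable_fun setT (fun p => f (sphere_R4 (sphere_rot k p)) <= f (sphere_R4 p)) /\
    measurable_fun setT (fun p => f (sphere_R4 p) <= f (sphere_R4 (sphere_rot k p))).
  move=> mf; have mfS := measurableT_comp mf mS.
  have mfT := measurableT_comp mf mT.
  by split; [exact: measurable_fun_ler mfT mfS|exact: measurable_fun_ler mfS mfT].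
(* The lexicographic [x <= y] unfolds to [x.1 <= y.1] together with [y.1 <= x.1 ==> x.2 <= y.2];
   this is why [mle] provides comparisons in both directions. *)
have mlex (b1 b2 b3 : S3 -> bool) : measurable_fun setT b1 ->
    measurable_fun setT b2 -> measurable_fun setT b3 ->
    measurable_fun setT (fun p => b1 p && (b2 p ==> b3 p)).
  by move=> mb1 mb2 mb3; apply: measurable_and => //; exact: measurable_implb.
have [l1 g1] := mle _ m1; have [l2 g2] := mle _ m2.
have [l3 g3] := mle _ m3; have [l4 g4] := mle _ m4.
have := mlex _ _ _ (mlex _ _ _ l1 g1 l2) (mlex _ _ _ g1 l1 g2)
  (mlex _ _ _ l3 g3 l4).
move=> /(_ measurableT [set true] I); rewrite setTI.
by congr (measurable _).
Qed.

Definition lens_section (x : lens R n) : S3 :=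
  xget (point : S3) [set p | lex_max p /\ lens_pi n p = x].

Lemma lens_sectionP x : lex_max (lens_section x) /\ lens_pi n (lens_section x) = x.
Proof.
rewrite /lens_section; case: xgetP => [p _ //|/(_ _)/=].
have [k hk] := lex_max_exists (repr x) => /(_ (sphere_rot k (repr x))) [].
split=> //; rewrite -[RHS]reprK; apply/esym/lens_pi_eq; by exists k.
Qed.

(** A set of classes is measurable when its preimage in S^3 is. Here that preimage is the saturation
    of the part of [B] inside [lex_max], a countable union of preimages under rotations. *)
Lemma measurable_lens_section : measurable_fun setT lens_section.
Proof.
move=> _ B mB; rewrite setTI.
suff : measurable (lens_pi n @^-1` (lens_section @^-1` B)).
  by rewrite -[X in measurable X -> _]setTI.
have -> : lens_pi n @^-1` (lens_section @^-1` B) =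
    \bigcup_k (sphere_rot k @^-1` (B `&` lex_max)).
  apply/seteqP; split=> p /=.
    move=> Bp; have [sm /esym /lens_pi_eq [k kE]] := lens_sectionP (lens_pi n p).
    by exists k => //=; rewrite -kE.
  move=> [k _ [Bk mk]]; have [sm sE] := lens_sectionP (lens_pi n p).
  rewrite (lex_max_unique sm mk)// sE; apply/lens_pi_eq; by exists k.
apply: bigcupT_measurable => k; rewrite -[X in measurable X]setTI.
apply: measurable_sphere_rot => //; exact: measurableI measurable_lex_max.
Qed.

Lemma measurable_hermitian : measurable_fun setT
  (fun z : S3 * S3 => hermitian (sphere_R4 z.1) (sphere_R4 z.2)).
Proof.
apply: (@measurableT_comp _ _ _ _ _ _ (fun z : R4 * R4 => hermitian z.1 z.2) _
  (fun z : S3 * S3 => (sphere_R4 z.1, sphere_R4 z.2))); last first.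
  apply: measurable_fun_pair.
    exact: (measurableT_comp measurable_sphere_R4 measurable_fst).
  exact: (measurableT_comp measurable_sphere_R4 measurable_snd).
have [m1 m2 m3 m4] := @measurable_R4_coord R.
have a1 := measurableT_comp m1 (@measurable_fst _ _ R4 R4).
have a2 := measurableT_comp m2 (@measurable_fst _ _ R4 R4).
have a3 := measurableT_comp m3 (@measurable_fst _ _ R4 R4).
have a4 := measurableT_comp m4 (@measurable_fst _ _ R4 R4).
have b1 := measurableT_comp m1 (@measurable_snd _ _ R4 R4).
have b2 := measurableT_comp m2 (@measurable_snd _ _ R4 R4).
have b3 := measurableT_comp m3 (@measurable_snd _ _ R4 R4).
have b4 := measurableT_comp m4 (@measurable_snd _ _ R4 R4).
rewrite /hermitian; apply: measurable_fun_pair.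
  by apply: measurable_funD; apply: measurable_funD; apply: measurable_funM.
by apply: measurable_funD; apply: measurable_funB; apply: measurable_funM.
Qed.

(* The Borel sigma-algebra of the product of two quotients is not given as the
   quotient of the product; a measurable section of lens_pi bridges the gap. *)
Lemma measurable_lens_comp d (T : measurableType d) (g : R2 -> T)
    (f : lens R n * lens R n -> T) : measurable_fun setT g ->
  (forall p q, f (lens_pi n p, lens_pi n q) =
               g (hermitian (sphere_R4 p) (sphere_R4 q))) ->
  measurable_fun setT f.
Proof.
move=> mg fE.
have -> : f = g \o (fun z : S3 * S3 => hermitian (sphere_R4 z.1) (sphere_R4 z.2))
    \o (fun z => (lens_section z.1, lens_section z.2)).
  apply/funext => -[x y] /=; rewrite -fE.
  by rewrite (lens_sectionP x).2 (lens_sectionP y).2.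
apply: measurableT_comp; first exact: measurableT_comp mg measurable_hermitian.
apply: measurable_fun_pair.
  exact: (measurableT_comp measurable_lens_section measurable_fst).
exact: (measurableT_comp measurable_lens_section measurable_snd).
Qed.

End measurable_section.

(** * The moment-generating function as an integral over the disk *)

Section reduction_to_disk.
Variables (R : realType) (n : nat).
Hypothesis n_gt1 : (1 < n)%N.
Local Notation mR := (measurableTypeR R).
Local Notation R2 := (mR * mR)%type.
Local Notation R4 := (R2 * R2)%type.
Local Notation S3 := (sphere3 R).
Local Notation leb2 := (@R2_lebesgue R).
Local Notation leb4 := (@R4_lebesgue R).

(** Off [-1, 1] [acos] is a choice in an empty set, hence constant there. On [-1, 1] it agrees with
    its composition with the clamping to that interval, which is monotone on the whole line. *)
Lemma measurable_acos : measurable_fun setT (@acos R : mR -> mR).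
Proof.
have out x : ~~ (-1 <= x <= 1) -> acos x = acos (2 : R).
  move=> hx; have empty y : ~~ (-1 <= y <= 1) ->
      [set z : R | 0 <= z <= pi /\ cos z = y] = set0.
    move=> hy; apply/seteqP; split=> // z [_ zy].
    by rewrite -zy cos_geN1 cos_le1 in hy.
  rewrite unlock (empty x)// (empty 2)//.
  by rewrite negb_and -!ltNge ltr1n orbT.
pose g x := acos (Num.max (-1) (Num.min x 1) : R).
have g_ni : nonincreasing_fun g.
  move=> x y xy; apply: le_acos.
  - by rewrite le_max lexx.
  - by rewrite ge_max ge_min lexx orbT andbT; lra.
  - by rewrite ge_max !le_max lexx /= le_min !ge_min xy lexx !orbT.
rewrite (_ : @acos R = fun x => if -1 <= x <= 1 then g x else acos 2).
  apply: measurable_fun_ifT => //.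
    by apply: measurable_and; exact: measurable_fun_ler.
  exact: nonincreasing_measurable.
apply/funext => x; case: ifPn => [/andP[x1 x2]|/out//].
by rewrite /g (min_idPl x2) (max_idPr x1).
Qed.

Definition exp_dist (t : R) (h : R2) : \bar R :=
  (expR (t * acos (max_re n h)))%:E.

Lemma exp_dist_ge0 t h : (0 <= exp_dist t h)%E.
Proof. by rewrite lee_fin expR_ge0. Qed.

Lemma measurable_exp_dist t : measurable_fun setT (exp_dist t).
Proof.
apply/measurable_EFinP; apply: measurableT_comp; first exact: measurable_expR.
apply: measurable_funM => //; apply: measurableT_comp; first exact: measurable_acos.
exact: measurable_max_re.
Qed.

Lemma ge0_integral_sphere3_prob (f : S3 -> \bar R) :
  measurable_fun setT f -> (forall p, 0 <= f p)%E ->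
  (\int[sphere3_prob R]_p f p =
   (fine (leb4 (R4_unit_ball (R:=R))))^-1%:E *
   \int[leb4]_(x in R4_unit_ball (R:=R)) f (radial_proj x))%E.
Proof.
move=> mf f0.
have VE : sphere3_cone_measure setT = leb4 (R4_unit_ball (R := R)).
  by rewrite /sphere3_cone_measure /pushforward /mrestr preimage_setT setTI.
have V0 : 0 <= (fine (leb4 (R4_unit_ball (R := R))))^-1.
  by rewrite invr_ge0 fine_ge0// -VE measure_ge0.
transitivity (\int[mscale (NngNum V0) (@sphere3_cone_measure R)]_p f p)%E.
  apply: eq_measure_integral => A mA _.
  by rewrite [LHS]sphere3_probE VE muleC.
rewrite (ge0_integral_mscale _ measurableT (NngNum V0) mf (fun p _ => f0 p)).
congr (_ * _)%E.
transitivity (\int[mrestr leb4 (measurable_R4_unit_ball (R := R))]_x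
  f (radial_proj x))%E; last first.
  exact: (ge0_integral_mrestr leb4 (@measurable_R4_unit_ball R)
    (measurableT_comp mf (@measurable_radial_proj R)) (fun x => f0 _)).
have := @ge0_integral_pushforward _ _ _ _ R _ (@measurable_radial_proj R)
  (mrestr leb4 (measurable_R4_unit_ball (R := R))) setT f measurableT mf
  (fun p _ => f0 p).
by rewrite preimage_setT.
Qed.

End reduction_to_disk.

Section mgf_on_disk.
Variables (R : realType) (n : nat).
Hypothesis n_gt1 : (1 < n)%N.
Local Notation mR := (measurableTypeR R).
Local Notation R2 := (mR * mR)%type.
Local Notation R4 := (R2 * R2)%type.
Local Notation S3 := (sphere3 R).
Local Notation leb2 := (@R2_lebesgue R).
Local Notation leb4 := (@R4_lebesgue R).
Local Notation ball4 := (@R4_unit_ball R).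

Lemma R4_origin_null : leb4 [set ((0, 0), (0, 0))] = 0%E.
Proof.
have E2 : leb2 ([set 0] `*` [set 0]) = 0%E.
  by rewrite /R2_lebesgue product_measure1E//= lebesgue_measure_set1 mule0.
have -> : [set ((0, 0), (0, 0))] =
    ([set 0] `*` [set 0]) `*` ([set 0] `*` [set 0]) :> set R4.
  by apply/seteqP; split=> [_ ->//|[[a b] [c d]] /= [[-> ->] [-> ->]]].
have m2 : measurable (([set 0] `*` [set 0]) : set R2) by exact: measurableX.
by rewrite /R4_lebesgue product_measure1E//= E2 mule0.
Qed.

Lemma R4_norm_eq0 (x : R4) : (R4_norm x == 0) = (x == ((0, 0), (0, 0))).
Proof.
case: x => [[a b] [c d]]; apply/eqP/eqP => [/eqP|[-> -> -> ->]].
  rewrite sqrtr_eq0 /R4_dot /= -!expr2 => h.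
  have := sqr_ge0 a; have := sqr_ge0 b; have := sqr_ge0 c; have := sqr_ge0 d.
  move=> d0 c0 b0 a0.
  have /eqP : a ^+ 2 = 0 by lra.
  have /eqP : b ^+ 2 = 0 by lra.
  have /eqP : c ^+ 2 = 0 by lra.
  have /eqP : d ^+ 2 = 0 by lra.
  by rewrite !sqrf_eq0 => /eqP -> /eqP -> /eqP -> /eqP ->.
by rewrite /R4_norm /R4_dot /= !mul0r !addr0 sqrtr0.
Qed.

Lemma measurable_R4_normV : measurable_fun setT (fun x : R4 => (R4_norm x)^-1 : mR).
Proof.
rewrite /R4_norm; apply: (measurableT_comp measurable_inv_sqrt).
by rewrite /R4_dot; polynomial_measurability.
Qed.

(** The first column of the matrix U is [q], so U e = q for e = (1, 0), and <U x, q> = <U x, U e> =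
    <x, e> because U is unitary. *)
Lemma hermitian_SU2_act (q x : R4) : R4_dot q q = 1 ->
  hermitian (SU2_act q.1 q.2 x) q = x.1.
Proof.
case: q x => [[a1 a2] [b1 b2]] [[x1 x2] [x3 x4]].
rewrite /R4_dot /hermitian /SU2_act /= => q1; congr pair.
  transitivity ((a1 * a1 + a2 * a2 + b1 * b1 + b2 * b2) * x1); first by ring.
  by rewrite q1 mul1r.
transitivity ((a1 * a1 + a2 * a2 + b1 * b1 + b2 * b2) * x2); first by ring.
by rewrite q1 mul1r.
Qed.

Lemma R4_norm_SU2_act (q x : R4) : R4_dot q q = 1 ->
  R4_norm (SU2_act q.1 q.2 x) = R4_norm x.
Proof.
case: q x => [[a1 a2] [b1 b2]] [[x1 x2] [x3 x4]]; rewrite /R4_norm.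
rewrite /R4_dot /SU2_act /= => q1; congr Num.sqrt.
transitivity ((a1 * a1 + a2 * a2 + b1 * b1 + b2 * b2) *
  (x1 * x1 + x2 * x2 + x3 * x3 + x4 * x4)); first by ring.
by rewrite q1 mul1r.
Qed.

(* The substitution x |-> SU2_act q x turns <x, q> into the first coordinate. *)
Lemma ge0_integral_hermitian (phi : R2 -> \bar R) (q : S3) :
  measurable_fun setT phi -> (forall h, 0 <= phi h)%E ->
  (\int[sphere3_prob R]_p phi (hermitian (sphere_R4 p) (sphere_R4 q)) *
   leb2 (disk 1) = \int[leb2]_(z in disk 1) phi z)%E.
Proof.
move=> mphi phi0; set y := sphere_R4 q.
have y1 : R4_dot y y = 1.
  by apply/eqP; rewrite /y /sphere_R4 -on_sphere3E; exact: (valP q).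
have mH : measurable_fun setT (fun x : R4 => hermitian x y).
  by rewrite /hermitian; polynomial_measurability.
pose Phi (x : R4) : \bar R := phi ((R4_norm x)^-1 * (hermitian x y).1,
  (R4_norm x)^-1 * (hermitian x y).2).
have mPhi : measurable_fun setT Phi.
  apply: (measurableT_comp mphi); apply: measurable_fun_pair;
    apply: (measurable_funM measurable_R4_normV).
    exact: (measurableT_comp measurable_fst mH).
  exact: (measurableT_comp measurable_snd mH).
have mS : measurable_fun setT
    (fun p : S3 => phi (hermitian (sphere_R4 p) y)).
  apply: (measurableT_comp mphi); apply: (measurableT_comp mH).
  exact: measurable_sphere_R4.
rewrite (ge0_integral_sphere3_prob mS (fun p => phi0 _)).
set V := leb4 ball4.
have radial : (\int[leb4]_(x in ball4)
    phi (hermitian (sphere_R4 (radial_proj x)) y) =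
    \int[leb4]_(x in ball4) Phi x)%E.
  apply: ge0_ae_eq_integral.
  - exact: measurable_R4_unit_ball.
  - apply: measurable_funTS.
    exact: (measurableT_comp mS (@measurable_radial_proj R)).
  - exact: measurable_funTS.
  - by move=> x _; exact: phi0.
  - by move=> x _; exact: phi0.
  (* [radial_proj x] is x / |x| only away from the origin, a null set. *)
  exists [set ((0, 0), (0, 0))]; split.
  - rewrite (_ : [set _] = ([set 0] `*` [set 0]) `*` ([set 0] `*` [set 0])).
      by apply: measurableX; exact: measurableX.
    by apply/seteqP; split=> [_ ->//|[[a b] [c d]] /= [[-> ->] [-> ->]]].
  - exact: R4_origin_null.
  move=> x /= h; apply/eqP; rewrite -R4_norm_eq0; apply/eqP.
  apply: contra_notP h => /eqP x0 _; rewrite /Phi /sphere_R4 radial_projE//.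
  rewrite of_R4K /hermitian /=; congr phi.
  by congr pair; ring.
have unitary : (\int[leb4]_(x in ball4) Phi x = \int[leb4]_(x in ball4)
    phi ((R4_norm x)^-1 * x.1.1, (R4_norm x)^-1 * x.1.2)%R)%E.
  have pU : preserves leb4 (SU2_act y.1 y.2).
    by apply: preserves_SU2_act; rewrite -y1 /R4_dot; ring.
  rewrite integral_mkcond -(preserves_ge0_integral pU).
  - rewrite [RHS]integral_mkcond; apply: eq_integral => x _; rewrite !patchE.
    rewrite /Phi R4_norm_SU2_act// hermitian_SU2_act//.
    congr (if _ then _ else _).
    by apply/idP/idP => /set_mem h; apply/mem_set; move: h;
      rewrite /R4_unit_ball/mkset R4_norm_SU2_act.
  - apply/(measurable_restrictT _ (@measurable_R4_unit_ball R)).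
    exact: measurable_funTS.
  - by move=> x; apply: erestrict_ge0 => z _; exact: phi0.
rewrite radial unitary ge0_integral_ball_direction//.
have /andP[V0 Voo] := sphere3_cone_measureT_fin_gt0 R.
have VE : sphere3_cone_measure setT = V.
  by rewrite /sphere3_cone_measure /pushforward /mrestr preimage_setT setTI.
rewrite VE in V0 Voo.
pose K := (leb2 (disk 1) *
  \int[@lebesgue_measure R]_(u in `[0%R, 1%R]) u%:E)%E.
rewrite -/K.
(* The integrand 1 in [ge0_integral_ball_direction] ties the constants together, so that neither the
   volume of the ball nor the area of the disk has to be known. *)
have KV : (K * leb2 (disk 1) = V)%E.
  have E : (V = K * \int[leb2]_(z in disk 1) cst 1 z)%E.
    etransitivity; last exact: (ge0_integral_ball_direction
      (measurable_cst 1%E) (fun=> lee01)).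
    have I4 := integral_cst leb4 (@measurable_R4_unit_ball R) 1%E.
    rewrite mul1e in I4; exact: esym I4.
  have I2 := integral_cst leb2 (@measurable_disk R 1) 1%E.
  rewrite mul1e in I2; rewrite E; congr (K * _)%E; exact: esym I2.
clear radial unitary; clearbody K V.
transitivity ((fine V)^-1%:E * (K * leb2 (disk 1) *
    \int[leb2]_(z in disk 1) phi z))%E.
  by rewrite -!muleA; congr (_ * (_ * _))%E; exact: muleC.
rewrite KV muleA -[V in X in (_ * X * _)%E]fineK; last first.
  by rewrite ge0_fin_numE ?ltW.
by rewrite -EFinM mulVf ?mul1e// gt_eqF// fine_gt0// V0 Voo.
Qed.

(** For a fixed second point the inner integral does not depend on that point, so integrating it
    against a probability measure returns it. The area of the disk stays a factor until [disk_area]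
    evaluates it. *)
Lemma lens_mgf_disk t :
  (lens_mgf n t * leb2 (disk 1) = \int[leb2]_(z in disk 1) exp_dist n t z)%E.
Proof.
pose F (z : lens R n * lens R n) : \bar R :=
  (expR (t * lens_dist z.1 z.2))%:E.
have FE p q : F (lens_pi n p, lens_pi n q) =
    exp_dist n t (hermitian (sphere_R4 p) (sphere_R4 q)).
  by rewrite /F /= lens_dist_max_re.
have mF : measurable_fun setT F.
  exact: (measurable_lens_comp n_gt1 (measurable_exp_dist n t) FE).
have F0 z : (0 <= F z)%E by rewrite lee_fin expR_ge0.
have iterated : (lens_mgf n t = \int[lens_prob R n]_y
    \int[lens_prob R n]_x F (x, y))%E.
  transitivity (\int[lens_prob R n \x lens_prob R n]_z F z)%E.
    rewrite /lens_mgf /mmt_gen_fun unlock; apply: eq_integral => z _.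
    by rewrite /F /= mulrC.
  by rewrite fubini_tonelli2.
have mG : measurable_fun setT (fun y => \int[lens_prob R n]_x F (x, y))%E.
  exact: (measurable_fun_fubini_tonelli_G (m1 := lens_prob R n) F mF F0).
have G0 y : (0 <= \int[lens_prob R n]_x F (x, y))%E by exact: integral_ge0.
have mFy y : measurable_fun setT (fun x => F (x, y)).
  by apply: (measurableT_comp mF); exact: measurable_fun_pair.
have inner q : (\int[lens_prob R n]_x F (x, lens_pi n q) =
    \int[sphere3_prob R]_p exp_dist n t (hermitian (sphere_R4 p) (sphere_R4 q)))%E.
  rewrite /lens_prob (ge0_integral_distribution _ (mFy _) (fun x => F0 _)).
  by apply: eq_integral => p _; rewrite -FE.
set I := (\int[leb2]_(z in disk 1) exp_dist n t z)%E.
have innerI q : (\int[lens_prob R n]_x F (x, lens_pi n q) * leb2 (disk 1) = I)%E.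
  rewrite inner; exact: (ge0_integral_hermitian q (measurable_exp_dist n t)
    (exp_dist_ge0 n t)).
rewrite iterated /lens_prob (ge0_integral_distribution _ mG G0).
have mGpi := measurableT_comp mG (@measurable_lens_pi R n).
have L0 : (0 <= leb2 (disk 1))%E by exact: measure_ge0.
etransitivity; first apply: esym.
  exact: (ge0_integralZr (sphere3_prob R) measurableT mGpi (fun q _ => G0 _) L0).
rewrite (eq_integral (cst I)); last by move=> q _; exact: innerI.
have I1 := integral_cst (sphere3_prob R) measurableT I.
have P1 := probability_setT (sphere3_prob R).
exact: (etrans I1 (etrans (congr1 (mule I) P1) (mule1 I))).
Qed.

End mgf_on_disk.

(** * The integral over the disk *)

Section sectors.
Variables (R : realType) (n : nat).
Hypothesis n_gt1 : (1 < n)%N.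
Local Notation mR := (measurableTypeR R).
Local Notation R2 := (mR * mR)%type.
Local Notation a := (half_angle R n 1).

(** The condition |arg z| < a multiplied out, so that it also covers n = 2: there cos a = 0, and the
    sector is the half plane [0 < z.1]. *)
Definition open_sector (z : R2) : bool := cos a * `|z.2| < z.1 * sin a.
Definition closed_sector (z : R2) : bool := cos a * `|z.2| <= z.1 * sin a.

Lemma open_sectorW z : open_sector z -> closed_sector z.
Proof. exact: ltW. Qed.

Lemma sin_a_gt0 : 0 < sin a.
Proof. exact: sin_half_angle_gt0. Qed.

Lemma a_gt0 : 0 < a.
Proof. by have /andP[] := half_angle_itv R n_gt1 (k := 1) n_gt1. Qed.

Lemma a_le_pihalf : a <= pi / 2.
Proof.
rewrite /half_angle mulr1 ler_pM2l ?pi_gt0// lef_pV2 ?posrE ?ltr0n ?ler_nat//.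
exact: ltnW.
Qed.

Lemma cos_a_ge0 : 0 <= cos a.
Proof.
apply: cos_ge0_pihalf; rewrite a_le_pihalf andbT (le_trans _ (ltW a_gt0))//.
by rewrite oppr_le0 divr_ge0 ?pi_ge0.
Qed.

Lemma cos_a_lt1 : cos a < 1.
Proof.
have s2 : 0 < sin a ^+ 2 by rewrite exprn_gt0// sin_a_gt0.
have := cos2Dsin2 a; have := cos_le1 a; have := cos_a_ge0; nra.
Qed.

(** For 0 < k < n the first factor is positive, so the sign of the linear form in [z] decides which
    real part is larger. *)
Lemma unit_rot_re k (z : R2) : z.1 - (unit_rot n k z).1 =
  2 * sin (half_angle R n k) *
  (z.1 * sin (half_angle R n k) + z.2 * cos (half_angle R n k)).
Proof.
rewrite /unit_rot /rot /= cos_mulr2n sin_mulr2n.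
by rewrite -(mulr_natr _ 2) cos2sin2 -(mulr_natr (cos _ * _)); ring.
Qed.

(** With h = [half_angle k] one has a <= h <= pi - a, so sin (h - a) and sin (h + a) are both
    nonnegative; the absolute value combines the two. *)
Lemma half_angle_sector k : (0 < k < n)%N ->
  sin a * `|cos (half_angle R n k)| <= cos a * sin (half_angle R n k).
Proof.
move=> k0n; have [/andP[k0 kn] /andP[h0 hpi]] := (k0n, half_angle_itv R n_gt1 k0n).
set h := half_angle R n k in h0 hpi *.
have ah : a <= h by rewrite /h /half_angle ler_pM2l ?divr_gt0 ?pi_gt0 ?ltr0n ?ler_nat// ltnW.
have aph : a + h <= pi.
  rewrite -half_angleS -(half_anglen R n_gt1) /half_angle.
  by rewrite ler_pM2l ?divr_gt0 ?pi_gt0 ?ltr0n ?ler_nat// ltnW.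
have a0 := a_gt0.
have s1 : 0 <= sin (h - a) by apply: sin_ge0_pi; lra.
have s2 : 0 <= sin (a + h) by apply: sin_ge0_pi; lra.
move: s1 s2; rewrite sinB (sinD a h) => s1 s2.
by case: (ger0P (cos h)) => _; lra.
Qed.

Lemma closed_sector_re k z : closed_sector z -> (0 < k < n)%N ->
  (unit_rot n k z).1 <= z.1.
Proof.
rewrite /closed_sector => hz k0n.
rewrite -subr_ge0 unit_rot_re; have s0 := sin_half_angle_gt0 R n_gt1 k0n.
apply: mulr_ge0; first by rewrite mulr_ge0 ?ltW.
(* After multiplication by sin a, the linear form is at least |y| (cos a sin h - sin a |cos h|),
   where y = [z.2] and h is the half angle; [half_angle_sector] bounds this below by 0. *)
rewrite -(pmulr_lge0 _ sin_a_gt0) mulrDl.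
have hk := half_angle_sector k0n; set s := sin (half_angle _ _ _) in s0 hk *.
set c := cos (half_angle _ _ _) in hk *.
have h1 : 0 <= (z.1 * sin a - cos a * `|z.2|) * s.
  by rewrite mulr_ge0 ?subr_ge0//; exact: ltW.
have h2 : 0 <= `|z.2| * (cos a * s - sin a * `|c|) by rewrite mulr_ge0 ?subr_ge0.
have h3 : - (`|z.2| * `|c|) <= z.2 * c.
  by rewrite lerNl -normrM -normrN ler_norm.
have h4 := ler_wpM2r (ltW sin_a_gt0) h3.
lra.
Qed.

Lemma open_sector_re k z : open_sector z -> (0 < k < n)%N ->
  (unit_rot n k z).1 < z.1.
Proof.
rewrite /open_sector => hz k0n.
rewrite -subr_gt0 unit_rot_re; have s0 := sin_half_angle_gt0 R n_gt1 k0n.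
apply: mulr_gt0; first by rewrite mulr_gt0.
rewrite -(pmulr_lgt0 _ sin_a_gt0) mulrDl.
have hk := half_angle_sector k0n; set s := sin (half_angle _ _ _) in s0 hk *.
set c := cos (half_angle _ _ _) in hk *.
have h1 : 0 < (z.1 * sin a - cos a * `|z.2|) * s by rewrite mulr_gt0 ?subr_gt0.
have h2 : 0 <= `|z.2| * (cos a * s - sin a * `|c|) by rewrite mulr_ge0 ?subr_ge0.
have h3 : - (`|z.2| * `|c|) <= z.2 * c.
  by rewrite lerNl -normrM -normrN ler_norm.
have h4 := ler_wpM2r (ltW sin_a_gt0) h3.
lra.
Qed.

Lemma max_re_sector z : closed_sector z -> max_re n z = z.1.
Proof.
move=> hz; have [[|k] kn kE] := max_re_attained n_gt1 z.
  by rewrite kE unit_rot0.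
apply/eqP; rewrite eq_le {1}kE closed_sector_re//=.
by rewrite -[z in X in X <= _](unit_rot0 n) max_re_ge// ltnW.
Qed.

(** If two rotates of z were in the open sector, a nontrivial rotation would lead from each to the
    other, and each would have a strictly smaller real part than the other. *)
Lemma open_sector_unique j k z : (j < n)%N -> (k < n)%N ->
  open_sector (unit_rot n j z) -> open_sector (unit_rot n k z) -> j = k.
Proof.
suff H i l : (i < l < n)%N -> open_sector (unit_rot n i z) ->
    ~ open_sector (unit_rot n l z).
  move=> jn kn hj hk; have [jk|kj|//] := ltngtP j k.
    by case: (H j k _ hj hk); rewrite jk kn.
  by case: (H k j _ hk hj); rewrite kj jn.
move=> /andP[il ln] hi hl.
have := @open_sector_re (l - i) _ hi; rewrite -unit_rotD subnK ?(ltnW il)//.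
rewrite subn_gt0 il (leq_ltn_trans (leq_subr _ _) ln) => /(_ isT).
have := @open_sector_re (n - (l - i)) _ hl; rewrite -unit_rotD.
have -> : (n - (l - i) + l = i + n)%N.
  by lia.
rewrite unit_rotD unit_rotn// => h1 h2.
have : (unit_rot n l z).1 < (unit_rot n l z).1.
  apply: lt_trans h2 (h1 _); apply/andP; split; lia.
by rewrite ltxx.
Qed.

(** Take the rotate w with the greatest real part. Comparing it with its rotates by 1 and by n - 1
    steps gives the inequalities for the two rays that bound the sector. *)
Lemma closed_sector_exists z : exists2 k, (k < n)%N & closed_sector (unit_rot n k z).
Proof.
have [k kn kE] := max_re_attained n_gt1 z; exists k => //.
set w := unit_rot n k z in kE *.
have wmax : max_re n w = w.1.
  rewrite -kE /w unit_rot_iter; elim: k {kn kE w} => //= k IH.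
  by rewrite max_re_unit_rot.
have hw j : (0 < j < n)%N ->
    0 <= w.1 * sin (half_angle R n j) + w.2 * cos (half_angle R n j).
  move=> j0n; have /andP[_ jn] := j0n.
  have := max_re_ge w jn; rewrite wmax -subr_ge0 unit_rot_re.
  by rewrite pmulr_rge0// mulr_gt0// sin_half_angle_gt0.
have h1 := hw 1%N n_gt1.
have := hw n.-1; have -> : half_angle R n n.-1 = pi - a.
  have E : half_angle R n n = a + half_angle R n n.-1.
    by rewrite -half_angleS prednK// ltnW.
  by rewrite -(half_anglen R n_gt1) E addrAC subrr add0r.
rewrite sinB cosB cospi sinpi !mul0r.
have i : (0 < n.-1 < n)%N by lia.
move=> /(_ i) h2; rewrite /closed_sector.
by case: (ger0P w.2) => _; lra.
Qed.

End sectors.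

Section sector_integral.
Variables (R : realType) (n : nat).
Hypothesis n_gt1 : (1 < n)%N.
Local Notation mR := (measurableTypeR R).
Local Notation leb := (@lebesgue_measure R).
Local Notation R2 := (mR * mR)%type.
Local Notation leb2 := (@R2_lebesgue R).
Local Notation a := (half_angle R n 1).

(** The rotation by 2 a is treated as the square of the rotation by a: [preserves_rot] requires a
    nonzero sine, and sin (2 a) = 0 for n = 2 while sin a > 0. *)
Lemma preserves_unit_rot k : preserves leb2 (unit_rot n k).
Proof.
have h : preserves leb2 (unit_rot (R := R) n 1).
  have hr : preserves leb2 (rot (cos a) (sin a)).
    by apply: preserves_rot; [exact: cos2Dsin2|rewrite gt_eqF// sin_a_gt0].
  rewrite (_ : unit_rot n 1 = rot (cos a) (sin a) \o rot (cos a) (sin a)).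
    exact: (preserves_comp hr hr).
  apply/funext => z; rewrite /unit_rot /rot /= cos_mulr2n sin_mulr2n.
  rewrite (_ : cos a ^+ 2 *+ 2 - 1 = cos a ^+ 2 - sin a ^+ 2).
    by congr pair; ring.
  by rewrite -(cos2Dsin2 a); ring.
rewrite (_ : unit_rot n k = iter k (unit_rot n 1)).
  exact: preserves_iter.
by apply/funext => z; exact: unit_rot_iter.
Qed.

Definition part (S : R2 -> bool) (G : R2 -> \bar R) (z : R2) : \bar R :=
  if S z then G z else 0%E.

Lemma measurable_part S G : measurable_fun setT S -> measurable_fun setT G ->
  measurable_fun setT (part S G).
Proof. by move=> mS mG; exact: measurable_fun_ifT. Qed.

Lemma measurable_open_sector : measurable_fun setT (open_sector (R := R) n).
Proof.
apply: measurable_fun_ltr; apply: measurable_funM => //.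
exact: measurableT_comp.
Qed.

Lemma measurable_closed_sector : measurable_fun setT (closed_sector (R := R) n).
Proof.
apply: measurable_fun_ler; apply: measurable_funM => //.
exact: measurableT_comp.
Qed.

(* The rotates of the open sector are disjoint and those of the closed one cover
   the plane, so that no null set needs to be discarded in the plane. *)
Lemma ge0_integral_rot_invariant (G : R2 -> \bar R) (L : R) :
  measurable_fun setT G -> (forall z, 0 <= G z)%E ->
  (forall z, G (unit_rot n 1 z) = G z) ->
  (\int[leb2]_z part (open_sector n) G z = L%:E)%E ->
  (\int[leb2]_z part (closed_sector n) G z = L%:E)%E ->
  (\int[leb2]_z G z = (L *+ n)%:E)%E.
Proof.
move=> mG G0 Grot1 LO LK.
have Grot k z : G (unit_rot n k z) = G z.
  by rewrite unit_rot_iter; elim: k => //= k IH; rewrite Grot1.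
pose N S z := (\sum_(k < n) part S G (unit_rot n k z))%E.
have part0 S z : (0 <= part S G z)%E by rewrite /part; case: ifP.
have mpart S k : measurable_fun setT S ->
    measurable_fun setT (fun z => part S G (unit_rot n k z)).
  move=> mS; apply: (measurableT_comp (measurable_part mS mG)).
  by have [] := preserves_unit_rot k.
have mN S : measurable_fun setT S -> measurable_fun setT (N S).
  by move=> mS; apply: emeasurable_sum => k; exact: mpart.
have N0 S z : (0 <= N S z)%E by apply: sume_ge0.
have intN S : measurable_fun setT S -> (\int[leb2]_z part S G z = L%:E)%E ->
    (\int[leb2]_z N S z = (L *+ n)%:E)%E.
  move=> mS intS; rewrite /N ge0_integral_sum//; last by move=> k; exact: mpart.
  rewrite (eq_bigr (fun=> L%:E)) ?sumEFin ?sumr_const ?card_ord// => k _.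
  rewrite -intS; exact: (preserves_ge0_integral (preserves_unit_rot k)
    (measurable_part mS mG)).
apply/eqP; rewrite eq_le; apply/andP; split.
  rewrite -(intN _ measurable_closed_sector LK); apply: ge0_le_integral => //.
    exact: mN measurable_closed_sector.
  move=> z _; have [k kn zk] := closed_sector_exists n_gt1 z.
  rewrite /N (bigD1 (Ordinal kn))//= {1}/part zk Grot leeDl// sume_ge0//.
rewrite -(intN _ measurable_open_sector LO); apply: ge0_le_integral => //.
  exact: mN measurable_open_sector.
move=> z _; rewrite /N.
have [[k hk]|none] := pselect (exists k : 'I_n, open_sector n (unit_rot n k z)).
  rewrite (bigD1 k)//= {1}/part hk Grot big1 ?adde0// => j jk.
  rewrite /part; case: ifPn => // hj; move: jk; rewrite -val_eqE /=.
  by rewrite (open_sector_unique n_gt1 (ltn_ord j) (ltn_ord k) hj hk) eqxx.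
rewrite big1// => k _; rewrite /part; case: ifPn => // hk.
by case: none; exists k.
Qed.

End sector_integral.

(** * The substitution x = cos r and the antiderivatives *)

Section acos_substitution.
Variable R : realType.
Local Notation leb := (@lebesgue_measure R).

(** A strictly decreasing surjection of [-1, 1] onto [0, pi] is continuous. *)
Lemma within_continuous_acos : {within `[-1, 1], continuous (@acos R)}.
Proof.
apply: segment_dec_surj_continuous.
  apply/le_nmono_in => x y; rewrite !in_itv /= => /andP[x1 x2] /andP[y1 y2] xy.
  rewrite -ltr_cos ?in_itv /= ?acos_ge0 ?acos_lepi ?x1 ?x2 ?y1 ?y2//.
  by rewrite !acosK ?in_itv /= ?x1 ?x2 ?y1 ?y2.
rewrite acos1 acosN1 => r /= ; rewrite in_itv /= => /andP[r0 rpi].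
exists (cos r); first by rewrite /= in_itv /= cos_geN1 cos_le1.
by rewrite cosK// in_itv /= r0.
Qed.

(** The derivative of [acos] at x is -1 / sin (acos x), so [\- (Q \o acos)] is an antiderivative. As
    [acos] is not differentiable at -1 and 1, the fundamental theorem is used with derivatives
    inside and mere continuity at the ends. *)
Lemma integral_acos (Q q : R -> R) (u v : R) :
  -1 <= u -> u < v -> v <= 1 -> continuous q ->
  (forall r : R, is_derive r 1 Q (q r * sin r)) ->
  (\int[leb]_(x in `[u, v]) (q (acos x))%:E = (Q (acos u) - Q (acos v))%:E)%E.
Proof.
move=> u1 uv v1 cq dQ.
have cacos : {within `[u, v], continuous (@acos R)}.
  apply: continuous_subspaceW within_continuous_acos => x /=.
  by rewrite !in_itv /= => /andP[ux xv]; rewrite (le_trans u1 ux) (le_trans xv v1).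
have comp (f : R -> R) : continuous f -> {within `[u, v], continuous (f \o @acos R)}.
  move=> cf x; exact: (@continuous_comp (subspace `[u, v]%classic) R R _ _ x
    (cacos x) (cf (acos x))).
have cQ : continuous Q.
  by move=> r; apply/differentiable_continuous/derivable1_diffP; have [] := dQ r.
have dF x : x \in `]u, v[ -> is_derive x 1 (\- (Q \o @acos R)) (q (acos x)).
  rewrite in_itv /= => /andP[ux xv].
  have x1 : -1 < x < 1 by rewrite (le_lt_trans u1 ux) (lt_le_trans xv v1).
  have dc := is_derive1_comp (dQ (acos x)) (is_derive1_acos x1).
  apply: is_derive_eq (is_deriveN dc) _.
  have x1' : -1 <= x <= 1 by move/andP: x1 => [/ltW -> /ltW ->].
  have s0 : sin (acos x) != 0.
    rewrite gt_eqF// sin_gt0_pi// acos_gt0 ?acos_ltpi//.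
      by move/andP: x1 => [-> /ltW ->].
    by move/andP: x1 => [/ltW -> ->].
  by rewrite -sin_acos// mulrN opprK mulfK.
rewrite (continuous_FTC2 (F := \- (Q \o @acos R)) uv).
- by rewrite -EFinB /=; congr EFin; ring.
- exact: comp.
- have := comp _ cQ; move=> /(continuous_within_itvP _ uv)[_ cu cv].
  by split=> [x /dF[]//||]; exact: cvgN.
- by move=> x xuv; rewrite derive1E; have [_] := dF x xuv.
Qed.

(* Q1 t and Q2 H t are antiderivatives of e^(tr) cos r sin r and of
   e^(tr) sin^2 r, where H is an antiderivative of e^(tr); leaving H free covers
   the case t = 0. *)
Definition Q1 (t r : R) : R :=
  expR (t * r) * (t * sin r * cos r - cos r ^+ 2 + sin r ^+ 2) / (4 + t ^+ 2).

Definition Q2 (H : R -> R) (t r : R) : R :=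
  (H r - expR (t * r) * (t * (cos r ^+ 2 - sin r ^+ 2) + 4 * sin r * cos r) /
    (4 + t ^+ 2)) / 2.

Lemma is_derive_expRM (t r : R) :
  is_derive r 1 (fun x => expR (t * x)) (t * expR (t * r)).
Proof.
have := is_derive1_comp (is_derive_expR (t * r)) (is_deriveZ t (is_derive_id r 1)).
by move=> /is_derive_eq; apply; rewrite /GRing.scale /= mulr1 mulrC.
Qed.

Lemma is_derive_Q1 (t r : R) :
  is_derive r 1 (Q1 t) (expR (t * r) * cos r * sin r).
Proof.
have t4 : 4 + t ^+ 2 != 0 by rewrite gt_eqF// ltr_pwDl// sqr_ge0.
have ds := is_derive_sin r; have dc := is_derive_cos r.
have := is_deriveZ (4 + t ^+ 2)^-1 (is_deriveM (is_derive_expRM t r)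
  (is_deriveD (is_deriveB (is_deriveZ t (is_deriveM ds dc)) (is_deriveM dc dc))
    (is_deriveM ds ds))).
set F := (X in is_derive _ _ X _) => dF.
have -> : Q1 t = F.
  apply/funext => x; rewrite /F /Q1 !fctE.
  by do 4?rewrite /GRing.scale /=; field.
by apply: is_derive_eq dF _; rewrite !fctE; do 4?rewrite /GRing.scale /=; field.
Qed.

Lemma is_derive_Q2 (H : R -> R) (t : R) :
  (forall r : R, is_derive r 1 H (expR (t * r))) ->
  forall r : R, is_derive r 1 (Q2 H t) (expR (t * r) * sin r * sin r).
Proof.
move=> dH r; have t4 : 4 + t ^+ 2 != 0 by rewrite gt_eqF// ltr_pwDl// sqr_ge0.
have ds := is_derive_sin r; have dc := is_derive_cos r.
have := is_deriveZ 2^-1 (is_deriveB (dH r) (is_deriveZ (4 + t ^+ 2)^-1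
  (is_deriveM (is_derive_expRM t r)
    (is_deriveD (is_deriveZ t (is_deriveB (is_deriveM dc dc) (is_deriveM ds ds)))
       (is_deriveZ 4 (is_deriveM ds dc)))))).
set F := (X in is_derive _ _ X _) => dF.
have -> : Q2 H t = F.
  by apply/funext => x; rewrite /F /Q2 !fctE; do 4?rewrite /GRing.scale /=; field.
apply: is_derive_eq dF _; rewrite !fctE; do 4?rewrite /GRing.scale /=.
have cE : cos r * cos r = 1 - sin r * sin r.
  by have := cos2Dsin2 r; rewrite !expr2 => <-; rewrite addrK.
set c := cos r in cE *; set s := sin r in cE *; set e := expR _.
(* This is sin^2 r = (1 - cos (2 r)) / 2; the summand 1 / 2 is the part that [H] integrates. *)
transitivity (e / 2 * (1 - (c * c - s * s))); first by field.
by rewrite cE; field.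
Qed.

End acos_substitution.

(** * Vertical slices of a sector of the disk *)

Section sector_slices.
Variables (R : realType) (n : nat).
Hypothesis n_gt1 : (1 < n)%N.
Local Notation mR := (measurableTypeR R).
Local Notation leb := (@lebesgue_measure R).
Local Notation R2 := (mR * mR)%type.
Local Notation leb2 := (@R2_lebesgue R).
Local Notation a := (half_angle R n 1).

(** For a region between the open and the closed sector, the end points of a slice are undetermined;
    they have measure 0. *)
Lemma lebesgue_measure_sandwich (A : set mR) (m : R) : measurable A -> 0 <= m ->
  `]- m, m[ `<=` A -> A `<=` `[- m, m] -> leb A = (2 * m)%:E.
Proof.
move=> mA m0 mleA Alem.
have itvE b1 b2 : leb [set` Interval (BSide b1 (- m)) (BSide b2 m)] = (2 * m)%:E.
  rewrite lebesgue_measure_itv /= lte_fin; case: ifPn => [_|].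
    by rewrite -EFinB; congr EFin; ring.
  by rewrite -leNgt => mm; congr EFin; lra.
apply/eqP; rewrite eq_le; apply/andP; split.
  by rewrite -(itvE true false); apply: le_measure; rewrite ?inE.
by rewrite -(itvE false true); apply: le_measure; rewrite ?inE.
Qed.

(** Half the length of the slice at abscissa x: the rays bound it up to x = cos a, the circle
    beyond. For n = 2 the branch with [tan a] is never taken, as x > 0 = cos a. *)
Definition half_chord (x : R) : R :=
  if (0 < x) && (x <= 1) then
    (if x <= cos a then x * tan a else Num.sqrt (1 - x ^+ 2)) else 0.

Lemma half_chord_ge0 x : 0 <= half_chord x.
Proof.
rewrite /half_chord; case: ifPn => // /andP[x0 _]; case: ifP => // _.
by rewrite mulr_ge0 ?(ltW x0)// /tan divr_ge0 ?(ltW (sin_a_gt0 _ _))// cos_a_ge0.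
Qed.

Lemma measurable_half_chord : measurable_fun setT (half_chord : mR -> mR).
Proof.
apply: measurable_fun_ifT => //.
  by apply: measurable_and; [exact: measurable_fun_ltr|exact: measurable_fun_ler].
apply: measurable_fun_ifT => //; first exact: measurable_fun_ler.
  exact: measurable_funM.
apply: (@measurableT_comp _ _ _ _ R R).
  by apply: continuous_measurable_fun; exact: sqrt_continuous.
by apply: measurable_funB => //; exact: measurable_funX.
Qed.

Definition slice (S : R2 -> bool) (x : R) : set mR :=
  [set y | S (x, y) && (sqnorm (x, y) <= 1)].

(** The abscissa 0 is excluded: for n = 2 the closed sector contains the whole vertical axis, so its
    slice has length 2 there, whereas [half_chord 0] is 0. *)
Lemma slice_measure (S : R2 -> bool) (x : R) : measurable (slice S x) ->
  (forall z, open_sector n z -> S z) -> (forall z, S z -> closed_sector n z) ->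
  x != 0 -> leb (slice S x) = (2 * half_chord x)%:E.
Proof.
move=> mS OS SK x0; have sa := sin_a_gt0 R n_gt1; have ca := cos_a_ge0 R n_gt1.
have cs := cos2Dsin2 a.
have null : slice S x = set0 -> half_chord x = 0 ->
    leb (slice S x) = (2 * half_chord x)%:E.
  by move=> -> ->; rewrite measure0 mulr0.
have [xneg|xpos|/eqP] := ltgtP x 0; last by rewrite (negbTE x0).
  apply: null; last by rewrite /half_chord ltNge ltW.
  apply/seteqP; split=> // y /andP[/SK + _]; rewrite /closed_sector /= => h.
  have : 0 <= cos a * `|y| by rewrite mulr_ge0.
  by move=> /le_trans/(_ h); rewrite pmulr_lge0// leNgt xneg.
have [x1|x1] := lerP x 1; last first.
  apply: null; last by rewrite /half_chord leNgt x1 andbF.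
  apply/seteqP; split=> // y /andP[_]; rewrite /sqnorm /= => h.
  by have := sqr_ge0 y; nra.
apply: lebesgue_measure_sandwich => //; first exact: half_chord_ge0.
(* Four goals: the open interval lies in the slice, then the slice lies in the closed interval, each
   for x <= cos a and for x > cos a. *)
all: rewrite /half_chord xpos x1 /=; have [xc|cx] := lerP x (cos a).
- have c0 : 0 < cos a by exact: lt_le_trans xc.
  move=> y /=; rewrite in_itv /= -ltr_norml /tan mulrA ltr_pdivlMr// => h.
  rewrite /slice /= OS /=; last by rewrite /open_sector /= mulrC.
  rewrite /sqnorm /= -(real_normK (num_real y)).
  have := normr_ge0 y; set w := `|y| in h *; move=> w0.
  (* It follows that (x^2 + w^2) cos^2 a <= x^2 <= cos^2 a, so the point is in the disk. *)
  have h2 : w ^+ 2 * cos a ^+ 2 <= x ^+ 2 * sin a ^+ 2.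
    by rewrite -!exprMn ler_sqr ?nnegrE ?mulr_ge0 ?(ltW xpos) ?(ltW sa)// ltW.
  have h3 : x ^+ 2 <= cos a ^+ 2 by rewrite ler_sqr ?nnegrE// ltW.
  rewrite -(ler_pM2r (exprn_gt0 2 c0)); nra.
- move=> y /=; rewrite in_itv /= -ltr_norml => h.
  have y2 : `|y| ^+ 2 < 1 - x ^+ 2.
    have p : 0 <= 1 - x ^+ 2 by nra.
    by rewrite -(sqr_sqrtr p) ltr_sqr ?nnegrE ?sqrtr_ge0.
  rewrite /slice /=; apply/andP; split; last first.
    by rewrite /sqnorm /= -(real_normK (num_real y)); lra.
  apply: OS; rewrite /open_sector /=.
  rewrite -ltr_sqr ?nnegrE ?mulr_ge0 ?(ltW xpos) ?(ltW sa)// !exprMn.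
  have h3 : cos a ^+ 2 < x ^+ 2 by rewrite ltr_sqr ?nnegrE// ltW.
  have sE : sin a ^+ 2 = 1 - cos a ^+ 2 by rewrite -cs; ring.
  have c20 := sqr_ge0 (cos a).
  rewrite sE; nra.
- have c0 : 0 < cos a by exact: lt_le_trans xc.
  move=> y /= /andP[/SK]; rewrite /closed_sector /= => h _.
  by rewrite in_itv /= -ler_norml /tan mulrA ler_pdivlMr// mulrC.
- move=> y /= /andP[_]; rewrite /sqnorm /= => h.
  rewrite in_itv /= -ler_norml -sqrtr_sqr ler_sqrt; first lra.
  by rewrite subr_ge0; nra.
Qed.

End sector_slices.

Section disk_integral.
Variables (R : realType) (n : nat).
Hypothesis n_gt1 : (1 < n)%N.
Local Notation mR := (measurableTypeR R).
Local Notation leb := (@lebesgue_measure R).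
Local Notation R2 := (mR * mR)%type.
Local Notation leb2 := (@R2_lebesgue R).
Local Notation a := (half_angle R n 1).
Variables (t : R) (H : R -> R).
Hypothesis dH : forall r : R, is_derive r 1 H (expR (t * r)).

Lemma acos_cos_a : acos (cos a) = a.
Proof.
rewrite cosK// in_itv /= (ltW (a_gt0 R n_gt1)) (le_trans (a_le_pihalf R n_gt1))//.
by rewrite ler_pdivrMr// ler_peMr ?pi_ge0// ler1n.
Qed.

Let E (x : R) := expR (t * acos x).

Let mE : measurable_fun setT (E : mR -> mR).
Proof.
apply: measurableT_comp; first exact: measurable_expR.
by apply: measurable_funM => //; exact: measurable_acos.
Qed.

Let f (x : R) : \bar R := (2 * half_chord n x * E x)%:E.

Let mf : measurable_fun setT (f : mR -> \bar R).
Proof.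
apply/measurable_EFinP; apply: measurable_funM => //.
by apply: measurable_funM => //; exact: measurable_half_chord.
Qed.

Let f0 x : (0 <= f x)%E.
Proof. by rewrite lee_fin !mulr_ge0 ?expR_ge0// half_chord_ge0. Qed.

Let cexp : continuous (fun r : R => expR (t * r)).
Proof.
by move=> r; apply: continuous_comp; [exact: mulrl_continuous|exact: continuous_expR].
Qed.

Lemma integral_straight_chords :
  (\int[leb]_(x in `]0%R, (cos a)]) f x =
   (2 * tan a * (Q1 t (pi / 2) - Q1 t a))%:E)%E.
Proof.
have := cos_a_ge0 R n_gt1; rewrite le_eqVlt => /predU1P[c0|c0].
  (* Here cos a = 0: the range of x is empty, and a = pi / 2 makes the right-hand side vanish. *)
  rewrite -{1}c0 set_itv_ge ?bnd_simp ?ltxx// integral_set0.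
  by rewrite -acos_cos_a -c0 acos0 subrr mulr0.
pose q r := 2 * tan a * (expR (t * r) * cos r).
have cq : continuous q.
  move=> r; apply: cvgM; first exact: cvg_cst.
  by apply: cvgM; [exact: cexp|exact: continuous_cos].
have dQ (r : R) : is_derive r 1 ((2 * tan a) *: Q1 t) (q r * sin r).
  apply: is_derive_eq (is_deriveZ (2 * tan a) (is_derive_Q1 t r)) _.
  by rewrite /q /GRing.scale /=; ring.
have mq (D : set R) : measurable D ->
    measurable_fun D (fun x : mR => (q (acos x))%:E).
  move=> mD; apply: measurable_funTS; apply/measurable_EFinP.
  apply: (@measurableT_comp _ _ _ _ R R); last exact: measurable_acos.
  exact: continuous_measurable_fun.
have c1 := cos_a_lt1 R n_gt1.
have N10 : -1 <= 0 :> R by lra.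
have := integral_acos N10 c0 (ltW c1) cq dQ.
rewrite acos0 acos_cos_a /= mulrBr => <-.
rewrite -integral_itv_obnd_cbnd; last exact: mq.
apply: eq_integral => x; rewrite inE /= in_itv /= => /andP[x0 xc].
rewrite /f /half_chord x0 xc (le_trans xc (ltW c1)) /= /q acosK.
  by rewrite /E; congr EFin; ring.
by rewrite in_itv /=; apply/andP; split; lra.
Qed.

Lemma integral_round_chords :
  (\int[leb]_(x in `](cos a), 1%R]) f x = (2 * (Q2 H t a - Q2 H t 0))%:E)%E.
Proof.
have c0 := cos_a_ge0 R n_gt1; have c1 := cos_a_lt1 R n_gt1.
pose q r := 2 * (expR (t * r) * sin r).
have cq : continuous q.
  move=> r; apply: cvgM; first exact: cvg_cst.
  by apply: cvgM; [exact: cexp|exact: continuous_sin].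
have dQ (r : R) : is_derive r 1 (2 *: Q2 H t) (q r * sin r).
  apply: is_derive_eq (is_deriveZ 2 (is_derive_Q2 dH r)) _.
  by rewrite /q /GRing.scale /=; ring.
have mq (D : set R) : measurable D ->
    measurable_fun D (fun x : mR => (q (acos x))%:E).
  move=> mD; apply: measurable_funTS; apply/measurable_EFinP.
  apply: (@measurableT_comp _ _ _ _ R R); last exact: measurable_acos.
  exact: continuous_measurable_fun.
have N1c : -1 <= cos a by lra.
have := integral_acos N1c c1 (lexx 1) cq dQ.
rewrite acos1 acos_cos_a /= mulrBr => <-.
rewrite -integral_itv_obnd_cbnd; last exact: mq.
apply: eq_integral => x; rewrite inE /= in_itv /= => /andP[cx x1].
rewrite /f /half_chord (le_lt_trans c0 cx) x1 /= leNgt cx /= /q sin_acos.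
  by rewrite /E; congr EFin; ring.
by apply/andP; split; lra.
Qed.

Let L : R := 2 * (tan a * (Q1 t (pi / 2) - Q1 t a) + (Q2 H t a - Q2 H t 0)).

Lemma integral_half_chord : (\int[leb]_x f x = L%:E)%E.
Proof.
have c0 := cos_a_ge0 R n_gt1; have c1 := cos_a_lt1 R n_gt1.
transitivity (\int[leb]_(x in `]0%R, 1%R]) f x)%E.
  rewrite [RHS]integral_mkcond; apply: eq_integral => x _; rewrite patchE.
  case: ifPn => //; rewrite notin_setE /= in_itv /= => /negP/negbTE h.
  by rewrite /f /half_chord h mulr0 mul0r.
have -> : `]0, 1]%classic = `]0, (cos a)]%classic `|` `](cos a), 1]%classic.
  apply/seteqP; split=> x /=; rewrite !in_itv /=.
    by move=> /andP[x0 x1]; have [xc|cx] := lerP x (cos a); [left|right];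
      rewrite ?x0 ?x1.
  by move=> [|] /andP[h1 h2]; apply/andP; split; lra.
rewrite ge0_integral_setU//; first last.
- apply/disj_setPS => x [] /=; rewrite !in_itv /= => /andP[_ h1] /andP[h2 _].
  by have := lt_le_trans h2 h1; rewrite ltxx.
- exact: measurable_funTS.
by rewrite integral_straight_chords integral_round_chords -EFinD; congr EFin;
  rewrite /L; ring.
Qed.

Let G := exp_dist n t \_ (disk 1).

Let mG : measurable_fun setT G.
Proof.
apply/(measurable_restrictT _ (@measurable_disk R 1)); apply: measurable_funTS.
exact: measurable_exp_dist.
Qed.

Let G0 z : (0 <= G z)%E.
Proof. by apply: erestrict_ge0 => x _; exact: exp_dist_ge0. Qed.

(** [S] is kept general because [ge0_integral_rot_invariant] needs the same value for the open and
    for the closed sector. *)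
Lemma integral_sector (S : R2 -> bool) : measurable_fun setT S ->
  (forall z, open_sector n z -> S z) -> (forall z, S z -> closed_sector n z) ->
  (\int[leb2]_z part S G z = L%:E)%E.
Proof.
move=> mS OS SK; have mP := measurable_part mS mG.
have P0 z : (0 <= part S G z)%E by rewrite /part; case: ifP.
transitivity (\int[leb]_x \int[leb]_y part S G (x, y))%E.
  exact: (fubini_tonelli1 (m1 := leb) (m2 := leb) (part S G) mP P0).
have mslice x : measurable (slice S x).
  have -> : slice S x = xsection ((S @^-1` [set true]) `&` disk 1) x.
    apply/seteqP; split=> y; rewrite /slice /xsection /disk /= inE /=.
      by move=> /andP[].
    by move=> [-> ->].
  apply: measurable_xsection; apply: measurableI; last exact: measurable_disk.
  by rewrite -[X in measurable X]setTI; exact: mS.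
have inner x : (\int[leb]_y part S G (x, y) = (E x)%:E * leb (slice S x))%E.
  rewrite -(integral_cst leb (mslice x)) [RHS]integral_mkcond.
  apply: eq_integral => y _; rewrite patchE /part /G patchE.
  have [Sxy|Sxy] := boolP (S (x, y)); last first.
    by rewrite memNset// /slice /= (negbTE Sxy).
  have [xy1|xy1] := boolP (sqnorm (x, y) <= 1).
    rewrite !mem_set ?/slice /= ?Sxy//.
    by rewrite /exp_dist (max_re_sector n_gt1 (SK _ Sxy)).
  by rewrite !memNset// /slice /disk /= ?Sxy; exact/negP.
under eq_integral do rewrite inner.
rewrite -integral_half_chord.
have mI : measurable_fun setT (fun x : mR => (E x)%:E * leb (slice S x))%E.
  have := measurable_fun_fubini_tonelli_F (m2 := leb) (part S G) mP P0.
  by rewrite /fubini_F; under eq_fun do rewrite inner.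
(* The abscissa 0, where [slice_measure] does not apply, is removed from both integrals. *)
have mT0 : measurable (setT `\ (0 : mR)) by exact: measurableD.
rewrite -[LHS](@integral_setD1 R _ 0)//; last exact: measurable_funTS.
rewrite -[RHS](@integral_setD1 R _ 0)//; last exact: measurable_funTS.
apply: eq_integral => x; rewrite inE /= => -[_ /eqP x0].
by rewrite (slice_measure n_gt1 (mslice x) OS SK x0) /f -EFinM mulrC.
Qed.

Lemma integral_disk_exp_dist :
  (\int[leb2]_(z in disk 1) exp_dist n t z = (L *+ n)%:E)%E.
Proof.
rewrite integral_mkcond; apply: (ge0_integral_rot_invariant n_gt1 mG G0).
- move=> z; rewrite /G !patchE /exp_dist max_re_unit_rot//.
  congr (if _ then _ else _).
  by apply/idP/idP => /set_mem h; apply/mem_set; move: h;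
    rewrite /disk /= sqnorm_unit_rot.
- by apply: integral_sector => [|//|z]; [exact: measurable_open_sector|
    exact: open_sectorW].
- by apply: integral_sector => [|z|//]; [exact: measurable_closed_sector|
    exact: open_sectorW].
Qed.

End disk_integral.

(** * The closed form *)

Section closed_form.
Variables (R : realType) (n : nat).
Hypothesis n_gt1 : (1 < n)%N.
Local Notation a := (half_angle R n 1).
Local Notation leb2 := (@R2_lebesgue R).

(* For n = 2, both sides vanish: tan (pi / 2) is 0 since x / 0 = 0. *)
Let tan_cos : tan a * cos a ^+ 2 = sin a * cos a.
Proof.
have [c0|c0] := eqVneq (cos a) 0; first by rewrite c0 expr0n /= !mulr0.
by rewrite /tan; field.
Qed.

Lemma disk_area : leb2 (disk 1) = pi%:E.
Proof.
have dH (r : R) : is_derive r 1 (@id R) (expR (0 * r)).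
  by rewrite mul0r expR0; exact: is_derive_id.
have := integral_disk_exp_dist n_gt1 dH.
rewrite (eq_integral (cst 1%E)); last first.
  by move=> z _; rewrite /exp_dist mul0r expR0.
have I2 := integral_cst leb2 (@measurable_disk R 1) 1%E.
rewrite mul1e in I2; move=> I3; rewrite -I2 I3; congr EFin.
rewrite /Q1 /Q2 !mul0r !expR0 cos_pihalf sin_pihalf cos0 sin0.
have n0 : n%:R != 0 :> R by rewrite pnatr_eq0 -lt0n ltnW.
have aE : a * n%:R = pi by rewrite /half_angle mulr1 divfK.
rewrite -mulr_natr -aE; have cs := cos2Dsin2 a.
have -> : sin a ^+ 2 = 1 - cos a ^+ 2 by rewrite -cs addrC addKr.
(* A sector splits into a triangle of area sin a cos a and a circular segment of area a - sin a cos
   a; the n sectors give n a = pi. *)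
transitivity (2 * ((tan a * cos a ^+ 2) / 2 + (a - sin a * cos a) / 2) * n%:R).
  by field.
by rewrite tan_cos; field.
Qed.

Lemma lens_mgfE (t : R) (H : R -> R) :
  (forall r : R, is_derive r 1 H (expR (t * r))) ->
  lens_mgf n t = (2 * (tan a * (Q1 t (pi / 2) - Q1 t a) +
    (Q2 H t a - Q2 H t 0)) * n%:R / pi)%:E.
Proof.
move=> dH; have := lens_mgf_disk n_gt1 t.
rewrite (integral_disk_exp_dist n_gt1 dH) disk_area.
have pi0 : (0 : R) < pi by exact: pi_gt0.
case: (lens_mgf n t) => [x|/=|/=].
- rewrite -EFinM => -[xE]; congr EFin.
  by apply: (mulIf (lt0r_neq0 pi0)); rewrite xE divfK ?gt_eqF// mulr_natr.
- by rewrite gt0_mulye// lte_fin.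
- by rewrite gt0_mulNye// lte_fin.
Qed.

Lemma lens_mgf0 : lens_mgf n (0 : R) = 1%E.
Proof.
have := lens_mgf_disk n_gt1 (0 : R).
rewrite (eq_integral (cst 1%E)); last first.
  by move=> z _; rewrite /exp_dist mul0r expR0.
have I2 := integral_cst leb2 (@measurable_disk R 1) 1%E.
rewrite mul1e in I2; move=> I3.
have := etrans (congr1 (mule _) (esym disk_area)) (etrans I3 (etrans I2 disk_area)).
have pi0 : (0 : R) < pi by exact: pi_gt0.
case: (lens_mgf n (0 : R)) => [x|/=|/=].
- rewrite -EFinM => -[xpi]; congr EFin.
  by apply: (mulIf (lt0r_neq0 pi0)); rewrite xpi mul1r.
- by rewrite gt0_mulye// lte_fin.
- by rewrite gt0_mulNye// lte_fin.
Qed.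

Lemma is_derive_expR_div (t r : R) : t != 0 ->
  is_derive r 1 (fun x => expR (t * x) / t) (expR (t * r)).
Proof.
move=> t0; have := is_deriveZ t^-1 (is_derive_expRM t r).
set F := (X in is_derive _ _ X _) => dF.
have -> : (fun x => expR (t * x) / t) = F.
  by apply/funext => x; exact: mulrC.
by apply: is_derive_eq dF _; rewrite /GRing.scale /= mulKf.
Qed.

End closed_form.

(** * Limits at t = 0 and the theorem *)

Lemma cvg_expRB1_div (R : realType) (k : R) :
  (expR (s * k) - 1) / s @[s --> (0 : R)^'] --> k.
Proof.
have [/= d1 d2] := is_derive_expRM k (0 : R).
have h : (fun s => s^-1 *: (((fun x => expR (k * x)) \o shift 0) (s *: 1) -
    expR (k * 0))) @ (0 : R)^' --> ('D_1 (fun x : R => expR (k * x)) 0 : R).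
  exact: d1.
rewrite d2 mulr0 expR0 mulr1 in h.
rewrite (_ : (fun s => _) = fun s => s^-1 *: (((fun x => expR (k * x)) \o shift 0)
  (s *: 1) - 1))//.
by apply/funext => s; rewrite /GRing.scale /= addr0 mulr1 mulrC (mulrC s).
Qed.

Lemma cvg_dnbhs (R : realType) (f : R -> R) (x : R) :
  {for x, continuous f} -> f s @[s --> x^'] --> f x.
Proof. by move=> cf; apply: cvg_trans cf; apply: cvg_app; exact: nbhs_dnbhs. Qed.

Theorem theorem3 (R : realType) (n : nat) (t : R) : (2 <= n)%N ->
  let F (s : R) : R :=
    if n == 2%N then
      4 / (pi * (4 + s ^+ 2)) *
        (2 * (expR (s * pi / 2) - 1) / s + s * expR (s * pi / 2))
    else
      2 * n%:R / (pi * (4 + s ^+ 2)) *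
        (2 * (expR (s * pi / n%:R) - 1) / s +
         tan (pi / n%:R) * (expR (s * pi / 2) - expR (s * pi / n%:R))) in
  (t != 0 -> lens_mgf n t = (F t)%:E) /\
  (t = 0 -> (F s)%:E @[s --> (0 : R)^'] --> lens_mgf n t).
Proof.
move=> n_gt1 F; have pi0 : pi != 0 :> R by rewrite gt_eqF// pi_gt0.
split=> [t0|->].
  rewrite (lens_mgfE n_gt1 (fun r => is_derive_expR_div r t0)); congr EFin.
  have t4 : 4 + t ^+ 2 != 0 by rewrite gt_eqF// ltr_pwDl// sqr_ge0.
  rewrite /Q1 /Q2 mulr0 cos_pihalf sin_pihalf cos0 sin0 expR0.
  have -> : half_angle R n 1 = pi / n%:R by rewrite /half_angle mulr1.
  rewrite /F -!(mulrA t pi); have [->|n2] := eqVneq n 2%N.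
    (* [tan (pi / 2)] has the default value 0, so only the chords ending on the circle
       contribute. *)
    rewrite tan_pihalf cos_pihalf sin_pihalf; set e := expR _.
    move: (pi : R) pi0 e => p p0 e; field.
    by rewrite t0 t4 p0.
  have Tc : tan (pi / n%:R) * cos (pi / n%:R) = sin (pi / n%:R) :> R.
    rewrite /tan divfK// gt_eqF// cos_gt0_pihalf//.
    have nR : (0 : R) < n%:R by rewrite ltr0n ltnW.
    rewrite ltr_pM2l ?pi_gt0// ltf_pV2 ?posrE// ltr_nat ltn_neqAle eq_sym n2.
    rewrite n_gt1 andbT (lt_trans (y := 0))// ?oppr_lt0 ?divr_gt0 ?pi_gt0//.
  have cs := cos2Dsin2 (pi / n%:R : R).
  set T := tan _ in Tc *; set c := cos _ in Tc cs *; set s := sin _ in Tc cs *.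
  set e1 := expR (t * (pi * n%:R^-1)); set e2 := expR (t * (pi * 2^-1)).
  move: (pi : R) pi0 e1 e2 T c s Tc cs => p p0 e1 e2 T c s Tc cs.
  (* Combines the trigonometric parts of [Q1] and [Q2] at a. The coefficient of [e1] becomes 1 / (2
     t) - (t / 2 + T) / (4 + t^2) = (2 / t - T) / (4 + t^2), as in [F]. *)
  have key : T * (t * s * c - c ^+ 2 + s ^+ 2) =
      t / 2 + T - (t * (c ^+ 2 - s ^+ 2) + 4 * s * c) / 2.
    have s2 : s ^+ 2 = 1 - c ^+ 2 by rewrite -cs; ring.
    transitivity (t * s * (T * c) - (T * c) * c + T - (T * c) * c).
      by rewrite s2; ring.
    rewrite Tc; have -> : t * s * s = t * s ^+ 2 by ring.
    by rewrite s2; field.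
  transitivity (2 * ((T * e2 - e1 * (T * (t * s * c - c ^+ 2 + s ^+ 2))) / (4 + t ^+ 2)
    + ((e1 / t - e1 * (t * (c ^+ 2 - s ^+ 2) + 4 * s * c) / (4 + t ^+ 2)) / 2
       - (1 / t - t / (4 + t ^+ 2)) / 2)) * n%:R / p).
    by field; rewrite t0 t4 p0.
  by rewrite key; field; rewrite t0 t4 p0.
rewrite lens_mgf0//.
suff FL : F s @[s --> (0 : R)^'] --> (1 : R).
  by apply: cvg_EFin => //; near=> s.
have n0 : n%:R != 0 :> R by rewrite pnatr_eq0 -lt0n ltnW.
have cexp d : expR (s * pi / d) @[s --> (0 : R)^'] --> (1 : R).
  under eq_fun do rewrite -mulrA; set k := pi / d.
  have ck : {for (0 : R), continuous (fun s : R => expR (s * k))}.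
    apply: continuous_comp; first exact: mulrr_continuous.
    exact: continuous_expR.
  by have := cvg_dnbhs ck; rewrite mul0r expR0.
have cdiv d : 2 * (expR (s * pi / d) - 1) / s @[s --> (0 : R)^'] --> 2 * (pi / d).
  rewrite (_ : (fun s => _) = fun s => 2 * ((expR (s * (pi / d)) - 1) / s)).
    by apply: cvgM; [exact: cvg_cst|exact: cvg_expRB1_div].
  by apply/funext => s; rewrite !mulrA.
have cinv : (pi * (4 + s ^+ 2))^-1 @[s --> (0 : R)^'] --> (pi * 4)^-1.
  apply: cvgV; first by rewrite mulf_neq0.
  apply: cvgM; first exact: cvg_cst.
  have c4 : {for (0 : R), continuous (fun s : R => 4 + s ^+ 2)}.
    by apply: cvgD; [exact: cvg_cst|exact: exprn_continuous].
  by have := cvg_dnbhs c4; rewrite expr0n addr0.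
have cid : s @[s --> (0 : R)^'] --> (0 : R).
  by apply: (@cvg_dnbhs R id); exact: cvg_id.
rewrite /F; have [n2|n2] := eqVneq n 2%N.
  (* The limit 1 is rewritten in the shape that the limit rules produce factor by factor. *)
  rewrite (_ : nbhs (1 : R) =
      nbhs (4 * (pi * 4)^-1 * (2 * (pi / 2) + 0 * 1) : R)); last first.
    by congr nbhs; move: (pi : R) pi0 => p p0; field.
  apply: cvgM; first by apply: cvgM; [exact: cvg_cst|exact: cinv].
  by apply: cvgD; [exact: cdiv|apply: cvgM; [exact: cid|exact: cexp]].
rewrite (_ : nbhs (1 : R) = nbhs (2 * n%:R * (pi * 4)^-1 *
    (2 * (pi / n%:R) + tan (pi / n%:R) * (1 - 1)) : R)); last first.
  congr nbhs; rewrite subrr mulr0 addr0; move: (pi : R) pi0 => p p0; field.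
  by rewrite n0 p0.
apply: cvgM; first by apply: cvgM; [exact: cvg_cst|exact: cinv].
apply: cvgD; first exact: cdiv.
by apply: cvgM; [exact: cvg_cst|apply: cvgB; exact: cexp].
Unshelve. all: by end_near.
Qed.
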